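(* Consider the reversible jump MCMC algorithm described in the context. Suppose that (E1) the state space $\Theta\times\mathcal{X}\times\mathbb{N}$ has a countably generated $\sigma$-algebra; (E2) the following densities are bounded: $p(\theta)$, $p(x_i\mid\theta)$, and $p(s\mid x_{1:n})$; (E3) for $i<j<k\in\mathbb{N}$, if $p(n=i)>0$ and $p(n=k)>0$, then $p(n=j)>0$; (E4) the supports of $p(x_i\mid\theta)$, $p(s\mid x_{1:n})$, and $p(n_{\mathrm{dp}}\mid n)$ do not depend on the quantity on the right-hand side of the conditioning bar; and further suppose that 1) $p(\theta)$ is a proper prior; 2) $p(s\mid x)$ and $p(n_{\mathrm{dp}}\mid n)$ satisfy $\epsilon_s$-DP and $\epsilon_n$-DP, respectively; 3) there exists $a>0$ such that $p(x_i\mid\theta)>a$ for all $x_i$ and all $\theta$; 4) $p(n)$ has finite support. Then the Markov chain generated by the algorithm is geometrically ergodic.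
   Context: Datasets are finite sequences $x=x_{1:n}=(x_1,\dots,x_n)\in\mathcal{X}=\bigcup_{n\ge1}\mathcal{X}_1^n$; a state is a triple $(\theta,x_{1:n},n)$ with $x_{1:n}\in\mathcal{X}_1^n$. DP is in the unbounded sense: two datasets are neighbors if they differ by the addition or removal of one entry, and a mechanism $M$ is $\epsilon$-DP if $P(M(x)\in S)\le e^{\epsilon}P(M(x')\in S)$ for all neighboring $x,x'$ and measurable $S$; for mechanisms with densities, the densities are understood to satisfy $p(s\mid x)\le e^{\epsilon}p(s\mid x')$ for neighboring $x,x'$. For $p(n_{\mathrm{dp}}\mid n)$, which depends on the data only through $n$, this means $p(n_{\mathrm{dp}}\mid n)\le e^{\epsilon_n}p(n_{\mathrm{dp}}\mid n')$ when $|n-n'|=1$. Model: prior density $p(\theta)$ on $\Theta$, prior $p(n)$ on $\mathbb{N}=\{1,2,\dots\}$, $x_1,\dots,x_n$ i.i.d. from $p(\cdot\mid\theta)$ given $(\theta,n)$, privatized summary $s\sim p(s\mid x_{1:n})$, privatized sample size $n_{\mathrm{dp}}\sim p(n_{\mathrm{dp}}\mid n)$. The observed $(s,n_{\mathrm{dp}})$ is fixed (in the common supports) and the target is the posterior $\pi=p(\theta,x_{1:n},n\mid s,n_{\mathrm{dp}})\propto p(\theta)p(n)\prod_{i=1}^np(x_i\mid\theta)\,p(s\mid x_{1:n})p(n_{\mathrm{dp}}\mid n)$. The mechanism for $s$ is record-additive: $p(s\mid x_{1:n})=g(s,\sum_{i=1}^nt(s,x_i))$ for known functions $g,t$. One iteration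 of the algorithm from state $(\theta,x_{1:n},n)$: 1. Within-model moves: (a) draw $\theta\sim p(\theta\mid x_{1:n})\propto p(\theta)\prod_ip(x_i\mid\theta)$. (b) For $i=1,\dots,n$ sequentially: propose $x_i^*\sim p(\cdot\mid\theta)$, let $x^*$ be $x$ with $x_i$ replaced by $x_i^*$, and accept (set $x=x^*$) with probability $\min\{1,p(s\mid x^* )/p(s\mid x)\}$. 2. Between-models move: draw $n^*$ from $q(n^*\mid n)$, where $q(2\mid1)=1$; $q(n\pm1\mid n)=1/2$ for $n>1$; and $q=0$ otherwise. If $n^*=n+1$, draw $x_{n+1}^*\sim p(\cdot\mid\theta)$ and set $x^*=(x_1,\dots,x_n,x_{n+1}^* )$; if $n^*=n-1$, set $x^*=(x_1,\dots,x_{n-1})$. Accept the move to $(n^*,x^* )$ with probability $$\min\left\{1,\frac{p(n^* )\,p(s\mid x^* )\,p(n_{\mathrm{dp}}\mid n^* )\,q(n\mid n^* )}{p(n)\,p(s\mid x)\,p(n_{\mathrm{dp}}\mid n)\,q(n^*\mid n)}\right\}.$$ Geometrically ergodic means: there is $\rho\in(0,1)$ such that for $\pi$-almost every starting state $z$ there is a finite constant $C(z)$ with total variation distance between the law of the chain after $t$ iterations and $\pi$ at most $C(z)\rho^t$ for all $t$. *)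

(* Defs.v *)
From HB Require Import structures.
From mathcomp Require Import all_boot all_order all_algebra.
From mathcomp Require Import all_classical all_reals all_analysis.

Set Implicit Arguments.
Unset Strict Implicit.
Unset Printing Implicit Defensive.

Import Order.TTheory GRing.Theory Num.Theory.

Local Open Scope classical_set_scope.
Local Open Scope ring_scope.

(* Nonempty finite sequences of records.  The index [k] stands for the sample
   size [k.+1], so that the empty dataset is excluded. *)
Definition dataset (X : Type) : Type := {k : nat & k.+1.-tuple X}.

Definition size_of X (x : dataset X) : nat := (tag x).+1.

Definition records X (x : dataset X) : seq X := val (tagged x).

Definition set_entry X (x : dataset X) (i : nat) (y : X) : dataset X :=
  existT (fun k => k.+1.-tuple X) (tag x)
    [tuple if j == i :> nat then y else tnth (tagged x) j | j < (tag x).+1].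

Definition append X (x : dataset X) (y : X) : dataset X :=
  existT (fun k => k.+1.-tuple X) (tag x).+1 [tuple of rcons (tagged x) y].

(* Removes the last record; a dataset of size 1 is left unchanged, but it is
   never asked to shrink since [size_proposal 0 1 = 0]. *)
Definition remove_last X (x : dataset X) : dataset X :=
  let: existT k v := x in
  match k return k.+1.-tuple X -> dataset X with
  | 0 => fun v => existT (fun k => k.+1.-tuple X) 0 v
  | k'.+1 => fun v => existT (fun k => k.+1.-tuple X) k'
      [tuple tnth v (widen_ord (leqnSn k'.+1) j) | j < k'.+1]
  end v.

Definition one_removed X (x y : dataset X) : Prop :=
  exists u a v, records x = u ++ a :: v /\ records y = u ++ v.

Definition neighbor X (x y : dataset X) : Prop :=
  one_removed x y \/ one_removed y x.

Definition neighbor_size (n m : nat) : Prop :=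
  [/\ (0 < n)%N, (0 < m)%N & n = m.+1 \/ m = n.+1].

(* The sigma-algebra of the disjoint union of the powers [X^n], [n >= 1]. *)
Definition dataset_display : measure_display -> measure_display.
Proof. exact. Qed.

Section measurable_dataset.
Context d (X : measurableType d).

HB.instance Definition _ := Choice.copy (dataset X) {k : nat & k.+1.-tuple X}.
HB.instance Definition _ := isPointed.Build (dataset X)
  (existT (fun k => k.+1.-tuple X) 0 [tuple point | i < 1]).

Definition dataset_measurable : set_system (dataset X) :=
  [set A | forall k, measurable
     [set v : k.+1.-tuple X | A (existT (fun k => k.+1.-tuple X) k v)]].

Let dataset_measurable0 : dataset_measurable set0.
Proof. by move=> k; exact: measurable0. Qed.

Let dataset_measurableC A : dataset_measurable A -> dataset_measurable (~` A).
Proof. by move=> mA k; exact: measurableC (mA k). Qed.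

Let dataset_measurable_bigcup (F : (set (dataset X))^nat) :
  (forall i, dataset_measurable (F i)) -> dataset_measurable (\bigcup_i F i).
Proof.
move=> mF k; rewrite [X in measurable X](_ : _ = \bigcup_i
    [set v : k.+1.-tuple X | F i (existT (fun k => k.+1.-tuple X) k v)]) //.
by apply: bigcup_measurable => i _; exact: mF.
Qed.

HB.instance Definition _ := @isMeasurable.Build (dataset_display d)
  (dataset X) dataset_measurable
  dataset_measurable0 dataset_measurableC dataset_measurable_bigcup.

End measurable_dataset.

Definition countably_generated d (T : measurableType d) : Prop :=
  exists G : (set T)^nat, @measurable d T = <<s range G >>.

(* Conditional densities are written [p a y] for "p(y | a)". *)
Section conditional_densities.
Context (R : realType) (A Y : Type).
Implicit Type p : A -> Y -> R.

Definition bounded_density p : Prop := exists B : R, forall a y, p a y <= B.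

Definition same_support (D : set A) p : Prop :=
  forall a b, D a -> D b -> forall y, 0 < p a y <-> 0 < p b y.

Definition dp_density (nbr : A -> A -> Prop) (eps : R) p : Prop :=
  forall a b, nbr a b -> forall y, p a y <= expR eps * p b y.

End conditional_densities.

(* [prior] is not required to be integrable: properness is a hypothesis of its
   own.  [prior_n], [size_mech] take the sample size [n >= 1] itself. *)
Record model (R : realType) dT dX dS dN (Theta : measurableType dT)
    (X : measurableType dX) (S : measurableType dS) (N : measurableType dN)
    (V : nmodType) := Model {
  base_theta : {sigma_finite_measure set Theta -> \bar R} ;
  base_x : {sigma_finite_measure set X -> \bar R} ;
  base_s : {sigma_finite_measure set S -> \bar R} ;
  base_ndp : {sigma_finite_measure set N -> \bar R} ;

  prior : Theta -> R ;
  prior_ge0 : forall th, 0 <= prior th ;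
  measurable_prior : measurable_fun [set: Theta] prior ;

  prior_n : nat -> R ;
  prior_n_ge0 : forall n, 0 <= prior_n n ;
  prior_n0 : prior_n 0 = 0 ;
  prior_n_sum : (\sum_(0 <= n <oo) (prior_n n)%:E = 1)%E ;

  lik : Theta -> X -> R ;
  lik_ge0 : forall th y, 0 <= lik th y ;
  measurable_lik : measurable_fun [set: Theta * X] (fun z => lik z.1 z.2) ;
  lik_int : forall th, (\int[base_x]_y (lik th y)%:E = 1)%E ;

  mech_g : S -> V -> R ;
  mech_t : S -> X -> V ;
  mech := fun (x : dataset X) (s : S) =>
    mech_g s (\sum_(y <- records x) mech_t s y) ;
  mech_ge0 : forall x s, 0 <= mech x s ;
  measurable_mech :
    measurable_fun [set: dataset X * S] (fun z => mech z.1 z.2) ;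
  mech_int : forall x, (\int[base_s]_s (mech x s)%:E = 1)%E ;

  size_mech : nat -> N -> R ;
  size_mech_ge0 : forall n, (0 < n)%N -> forall m, 0 <= size_mech n m ;
  measurable_size_mech :
    forall n, (0 < n)%N -> measurable_fun [set: N] (size_mech n) ;
  size_mech_int :
    forall n, (0 < n)%N -> (\int[base_ndp]_m (size_mech n m)%:E = 1)%E
}.

Section algorithm.
Context (R : realType) dT dX dS dN (Theta : measurableType dT)
  (X : measurableType dX) (S : measurableType dS) (N : measurableType dN)
  (V : nmodType).
Variables (M : model R Theta X S N V) (s : S) (ndp : N).

(* The triple [(theta, x_{1:n}, n)], with [n = size_of x]. *)
Definition state : Type := (Theta * dataset X)%type.

Definition lik_data (th : Theta) (x : dataset X) : R :=
  \prod_(y <- records x) lik M th y.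

Definition joint_density (z : state) : R :=
  prior M z.1 * prior_n M (size_of z.2) * lik_data z.1 z.2
    * mech M z.2 s * size_mech M (size_of z.2) ndp.

(* Iterated integral with respect to the n-fold power of [base_x]. *)
Fixpoint tuple_integral (n : nat) : (n.-tuple X -> \bar R) -> \bar R :=
  match n return (n.-tuple X -> \bar R) -> \bar R with
  | 0 => fun f => f [tuple]
  | n'.+1 => fun f =>
      (\int[base_x M]_y tuple_integral (fun v => f [tuple of y :: v]))%E
  end.

Definition state_integral (f : state -> \bar R) : \bar R :=
  (\sum_(0 <= k <oo) \int[base_theta M]_th
     tuple_integral (fun v : k.+1.-tuple X =>
       f (th, existT (fun k => k.+1.-tuple X) k v)))%E.

Definition posterior (U : set state) : \bar R :=
  ((fine (state_integral (fun z => (joint_density z)%:E)))^-1%:E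
    * state_integral (fun z => (joint_density z * \1_U z)%:E))%E.

(* Each move is given by its Markov operator on nonnegative functions,
   [f |-> (z |-> E[f(Z') | Z = z])], where [Z'] is the state after the move
   from [Z]. *)

Definition theta_move (f : state -> \bar R) (z : state) : \bar R :=
  ((fine (\int[base_theta M]_th (prior M th * lik_data th z.2)%:E))^-1%:E
    * \int[base_theta M]_th
        ((prior M th * lik_data th z.2)%:E * f (th, z.2)))%E.

Definition accept_or_stay (alpha : R) (f : state -> \bar R) (z' z : state) :
    \bar R :=
  (alpha%:E * f z' + (1 - alpha)%:E * f z)%E.

(* [i] is counted from 0. *)
Definition entry_move (i : nat) (f : state -> \bar R) (z : state) : \bar R :=
  (\int[base_x M]_y ((lik M z.1 y)%:E *
     accept_or_stay (Num.min 1 (mech M (set_entry z.2 i y) s / mech M z.2 s))%R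
       f (z.1, set_entry z.2 i y) z))%E.

(* [entry_move] number 0 acts on the state first, hence is applied last to
   the function. *)
Definition sweep (f : state -> \bar R) (z : state) : \bar R :=
  foldr entry_move f (iota 0 (size_of z.2)) z.

(* [size_proposal m n] is q(m | n). *)
Definition size_proposal (m n : nat) : R :=
  if n == 1%N then (m == 2%N)%:R
  else if (m == n.+1) || (n == m.+1) then 2^-1 else 0.

Definition jump_accept (x' x : dataset X) : R :=
  Num.min 1
    ((prior_n M (size_of x') * mech M x' s * size_mech M (size_of x') ndp
        * size_proposal (size_of x) (size_of x'))
     / (prior_n M (size_of x) * mech M x s * size_mech M (size_of x) ndp
        * size_proposal (size_of x') (size_of x))).

Definition jump_move (f : state -> \bar R) (z : state) : \bar R :=
  let: (th, x) := z in let n := size_of x in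
  ((size_proposal n.+1 n)%:E * (\int[base_x M]_y ((lik M th y)%:E *
      accept_or_stay (jump_accept (append x y) x) f (th, append x y) z))
   + (size_proposal n.-1 n)%:E *
      accept_or_stay (jump_accept (remove_last x) x) f (th, remove_last x) z)%E.

Definition iteration (f : state -> \bar R) : state -> \bar R :=
  theta_move (sweep (jump_move f)).

(* Law of the chain after [t] iterations from [z]. *)
Definition chain (t : nat) (z : state) (U : set state) : \bar R :=
  iter t iteration (fun w => (\1_U w)%:E) z.

End algorithm.

Definition tv_dist (R : realType) d (T : measurableType d)
    (mu nu : set T -> \bar R) : \bar R :=
  ereal_sup [set `|mu U - nu U|%E | U in [set U | measurable U]].

(* [P t z] is the law after [t] iterations from [z]. *)
Definition geometrically_ergodic (R : realType) d (T : measurableType d)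
    (P : nat -> T -> set T -> \bar R) (pi : set T -> \bar R) : Prop :=
  exists rho : R, [/\ 0 < rho, rho < 1 &
    {ae pi, forall z, exists C : R, forall t : nat,
      (tv_dist (P t z) pi <= (C * rho ^+ t)%:E)%E}].

(* Main.v *)
(* On the set D of states whose sample size has positive prior probability, the
   chain satisfies a uniform Doeblin condition.  D is absorbing, because a jump
   to a size of prior probability zero is never accepted.  All acceptance
   probabilities on D are bounded below: two datasets can be compared through
   their concatenation, whose mechanism density is within a power of e^eps_s of
   both.  As p(y | theta) lies between two positive constants, the parameter
   draw dominates a multiple of the prior, and a sweep then dominates a multiple
   of the operator that refreshes every record from p(. | theta), which forgets
   the old records.  The size climbs to the largest supported size, where it can
   stay since upward proposals are rejected there (this also prevents
   periodicity); after as many iterations as this size, every starting point of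
   D has regenerated with probability at least c.  The oscillation of
   P^t f over D therefore contracts geometrically.  The posterior is stationary
   because every move satisfies detailed balance, and it charges only D, so it
   averages P^t f over D. *)

Require Import Defs.
From mathcomp Require Import all_boot all_order all_algebra.
From mathcomp Require Import all_classical all_reals all_analysis.
From mathcomp Require Import measurable_realfun.
From mathcomp Require Import ring.

Set Implicit Arguments.
Unset Strict Implicit.
Unset Printing Implicit Defensive.

Import Order.TTheory GRing.Theory Num.Theory.

Local Open Scope classical_set_scope.
Local Open Scope ring_scope.

(** * Measurability on the disjoint union of the powers of X *)

(** No kernel is ever constructed: each move is handled through its action on nonnegative
    extended-real functions, so a lower bound on a transition probability appears as an inequality
    between operators. Two obstacles shape the argument. Subtraction behaves badly in [\bar R],
    hence balance equations are equalities between sums of nonnegative parts, and oscillation is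
    controlled by truncated differences. Outside the supported sizes functions obey no bounds and
    acceptance ratios have denominator 0, hence monotonicity is relativized to a set of sizes. The
    difficulty in the minorization is that the parameter is drawn given the records and the records
    given the parameter; the two bounds on the likelihood cut this loop, as they reduce the
    influence of the records on the parameter draw to a factor depending on the size alone.
    Differential privacy is paid for by a factor exponential in the sizes, which is harmless because
    the sizes are bounded. Stationarity serves to place the posterior of an event between the bounds
    for the chain. *)

Section integral_nonneg.
Local Open Scope ereal_scope.
Context d (T : measurableType d) (R : realType).
Variable mu : {measure set T -> \bar R}.

Import HBNNSimple.

(** The integral of a nonnegative function is a supremum over the simple functions below it, which
    is monotone for any function, measurable or not. Later comparisons thus create no measurability
    obligations. *)
Lemma le_integral_nonneg (f g : T -> \bar R) :
  (forall x, 0 <= f x) -> (forall x, f x <= g x) ->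
  \int[mu]_x f x <= \int[mu]_x g x.
Proof.
move=> f0 fg; have g0 x : 0 <= g x by exact: le_trans (fg x).
rewrite !ge0_integralTE//; apply: ereal_sup_le => _ [h hf <-].
by exists h => // x; exact: le_trans (fg x).
Qed.

Lemma integralZl_fin (c : R) (f : T -> \bar R) :
  measurable_fun [set: T] f -> (forall x, 0 <= f x) -> (0 <= c)%R ->
  \int[mu]_x (c%:E * f x) = c%:E * \int[mu]_x f x.
Proof. by move=> mf f0 c0; rewrite ge0_integralZl. Qed.

End integral_nonneg.

(** On nonnegative reals, 0 included, the inverse is the power of exponent -1. *)
Lemma measurable_invr_ge0 d (T : measurableType d) (R : realType) (f : T -> R) :
  (forall x, 0 <= f x) -> measurable_fun [set: T] f ->
  measurable_fun [set: T] (fun x => (f x)^-1).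
Proof.
move=> f0 mf; under eq_fun do rewrite -powR_inv1//.
exact: measurableT_comp (measurable_powR (-1)) mf.
Qed.

Section parametric_integral.
Local Open Scope ereal_scope.
Context d d' (T : measurableType d) (Y : measurableType d') (R : realType).
Variable mu : {sigma_finite_measure set Y -> \bar R}.

Lemma measurable_parametric (f : T -> Y -> \bar R) :
  (forall t y, 0 <= f t y) ->
  measurable_fun [set: T * Y] (fun p => f p.1 p.2) ->
  measurable_fun [set: T] (fun t => \int[mu]_y f t y).
Proof.
move=> f0 mf.
by apply: (measurable_fun_fubini_tonelli_F (fun p => f p.1 p.2)).
Qed.

End parametric_integral.

Section measurable_fibers.
Context d (X : measurableType d).

Definition mkdata k (v : k.+1.-tuple X) : dataset X :=
  existT (fun k => k.+1.-tuple X) k v.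

Lemma measurable_mkdata k : measurable_fun [set: k.+1.-tuple X] (@mkdata k).
Proof. by move=> _ A mA; rewrite setTI; exact: mA. Qed.

Lemma measurable_fun_data d' (Y : measurableType d') (f : dataset X -> Y) :
  (forall k, measurable_fun [set: k.+1.-tuple X] (f \o @mkdata k)) ->
  measurable_fun [set: dataset X] f.
Proof.
move=> mf _ A mA; rewrite setTI.
suff : dataset_measurable (f @^-1` A) by [].
move=> k; by have := mf k measurableT _ mA; rewrite setTI.
Qed.

(** A measurable left inverse of [mkdata k], with a dummy value on the other sizes. It pulls a
    function known on one power of [X] back to all datasets. *)
Definition retract k (x : dataset X) : k.+1.-tuple X :=
  let: existT j v := x in
  match @eqP _ j k with
  | ReflectT e => eq_rect j (fun i => i.+1.-tuple X) v k e
  | ReflectF _ => [tuple point | i < k.+1]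
  end.

Arguments retract : simpl never.

Lemma retractK k v : retract k (mkdata v) = v.
Proof.
by rewrite /retract /=; case: eqP => // e; rewrite eq_axiomK.
Qed.

Lemma measurable_retract k : measurable_fun [set: dataset X] (@retract k).
Proof.
apply: measurable_fun_data => j; rewrite /retract /comp /=.
case: eqP => [e|ne]; last first.
  exact: (measurable_cst [tuple point | i < k.+1]).
by case: _ / e; exact: measurable_id.
Qed.

Lemma measurable_of_size (P : set nat) :
  measurable [set x : dataset X | P (size_of x)].
Proof.
suff : dataset_measurable [set x : dataset X | P (size_of x)] by [].
move=> k; rewrite /size_of /=.
have [Pk|Pk] := pselect (P k.+1).
  by rewrite [X in measurable X](_ : _ = setT)//; apply/seteqP; split.
by rewrite [X in measurable X](_ : _ = set0)//; apply/seteqP; split.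
Qed.

Lemma measurable_fun_size d' (Y : measurableType d') (f : nat -> Y) :
  measurable_fun [set: dataset X] (fun x => f (size_of x)).
Proof. by apply: measurable_fun_data => k; exact: (measurable_cst (f k.+1)). Qed.

(* A product with [dataset X] is the countable disjoint union of the
   products with the powers of [X]. *)
Lemma measurable_fun_fibers d1 d2 (T : measurableType d1) (Y : measurableType d2)
    (f : T * dataset X -> Y) :
  (forall k, measurable_fun [set: T * k.+1.-tuple X]
    (fun p => f (p.1, mkdata p.2))) ->
  measurable_fun [set: T * dataset X] f.
Proof.
move=> mf _ A mA; rewrite setTI.
rewrite [X in measurable X](_ : _ = \bigcup_k
  ((snd @^-1` [set x : dataset X | size_of x = k.+1]) `&`
   ((fun p : T * dataset X => (p.1, retract k p.2)) @^-1`
    ((fun p => f (p.1, mkdata p.2)) @^-1` A)))); last first.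
  apply/seteqP; split => [[t [k v]] /= Ap|[t [k v]] /= [j _ []]].
    by exists k => //=; split => //; rewrite retractK.
  by rewrite /size_of /= => -[<-]; rewrite retractK.
apply: bigcup_measurable => k _; apply: measurableI.
  rewrite -[X in measurable X]setTI; apply: measurable_snd => //.
  exact: (measurable_of_size [set n | n = k.+1]).
have m1 : measurable_fun setT (fun p : T * dataset X => (p.1, retract k p.2)).
  apply: measurable_fun_pair => //.
  exact: (measurableT_comp (@measurable_retract k)).
rewrite -[X in measurable X]setTI; apply: m1 => //.
by rewrite -[X in measurable X]setTI; exact: mf.
Qed.

Lemma measurable_append : measurable_fun [set: X * dataset X]
  (fun p => append p.2 p.1).
Proof.
apply: measurable_fun_fibers => k /=; apply: (measurableT_comp (@measurable_mkdata k.+1)).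
apply/measurable_fun_tnthP => i /=.
have [ik|ik] := ltnP i k.+1.
  rewrite (_ : _ \o _ = fun p : X * k.+1.-tuple X => tnth p.2 (Ordinal ik)).
    apply: (measurableT_comp (f := fun v : k.+1.-tuple X => tnth v (Ordinal ik))) => //.
    exact: measurable_tnth.
  apply/funext => p /=; rewrite !(tnth_nth p.1) /=.
  by rewrite nth_rcons size_tuple ik.
rewrite (_ : _ \o _ = fst) //.
apply/funext => p /=; rewrite !(tnth_nth p.1) /=.
have -> : i = k.+1 :> nat by apply/eqP; rewrite eqn_leq ik -ltnS ltn_ord.
by rewrite nth_rcons size_tuple ltnn eqxx.
Qed.

Lemma measurable_set_entry i : measurable_fun [set: X * dataset X]
  (fun p => set_entry p.2 i p.1).
Proof.
apply: measurable_fun_fibers => k /=; apply: (measurableT_comp (@measurable_mkdata k)).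
apply/measurable_fun_tnthP => j /=.
have [ji|ji] := eqVneq (j : nat) i.
  rewrite (_ : _ \o _ = fst) //.
  by apply/funext => p /=; rewrite tnth_mktuple ji eqxx.
rewrite (_ : _ \o _ = fun p : X * k.+1.-tuple X => tnth p.2 j).
  apply: (measurableT_comp (f := fun v : k.+1.-tuple X => tnth v j)) => //.
  exact: measurable_tnth.
by apply/funext => p /=; rewrite tnth_mktuple (negbTE ji).
Qed.

Lemma measurable_remove_last :
  measurable_fun [set: dataset X] (@remove_last X).
Proof.
apply: measurable_fun_data => -[|k] /=; first exact: (@measurable_mkdata 0).
apply: (measurableT_comp (@measurable_mkdata k)).
apply/measurable_fun_tnthP => j /=.
rewrite (_ : _ \o _ = fun v : k.+2.-tuple X => tnth v (widen_ord (leqnSn k.+1) j)).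
  exact: measurable_tnth.
by apply/funext => p /=; rewrite tnth_mktuple.
Qed.

End measurable_fibers.

(** * Iterated integrals over tuples *)

Section tuple_integral.
Local Open Scope ereal_scope.
Context (R : realType) dT dX dS dN (Theta : measurableType dT)
  (X : measurableType dX) (S : measurableType dS) (N : measurableType dN)
  (V : nmodType) (M : model R Theta X S N V).

Notation TI := (tuple_integral M).

Lemma measurable_cons_pair n :
  measurable_fun [set: X * n.-tuple X] (fun p => [tuple of p.1 :: p.2]).
Proof. exact: measurable_cons. Qed.

Lemma tuple_integral_ge0 n (f : n.-tuple X -> \bar R) :
  (forall v, 0 <= f v) -> 0 <= TI f.
Proof.
by elim: n f => [f ->//|n IH f f0] /=; apply: integral_ge0 => y _; exact: IH.
Qed.

Lemma le_tuple_integral n (f g : n.-tuple X -> \bar R) :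
  (forall v, 0 <= f v) -> (forall v, f v <= g v) -> TI f <= TI g.
Proof.
elim: n f g => [f g _ ->//|n IH f g f0 fg] /=.
apply: le_integral_nonneg => y; first exact: tuple_integral_ge0.
by apply: IH.
Qed.

(** The parameter space is generalized in the induction: once the first coordinate is split off, it
    becomes part of the parameter, in [T * X]. *)
Lemma measurable_tuple_integral d (T : measurableType d) n
    (F : T -> n.-tuple X -> \bar R) :
  (forall t v, 0 <= F t v) ->
  measurable_fun [set: T * n.-tuple X] (fun p => F p.1 p.2) ->
  measurable_fun [set: T] (fun t => TI (F t)).
Proof.
elim: n d T F => [d T F F0 mF|n IH d T F F0 mF] /=.
  apply: (measurableT_comp (f := fun p => F p.1 p.2) (g := fun t => (t, [tuple]))) => //.
apply: (@measurable_parametric _ _ _ _ _ (base_x M)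
  (fun t y => TI (fun v => F t [tuple of y :: v]))) => [t y|].
  exact: tuple_integral_ge0.
apply: (IH _ _ (fun p v => F p.1 [tuple of p.2 :: v])) => //=.
apply: (measurableT_comp (f := fun p => F p.1 p.2)
  (g := fun p : (T * X) * n.-tuple X => (p.1.1, [tuple of p.1.2 :: p.2]))) => //.
apply: measurable_fun_pair => /=.
  exact: (measurableT_comp measurable_fst).
apply: measurable_cons => //.
exact: (measurableT_comp measurable_snd).
Qed.

Section sections.
Variables (n : nat) (f : n.+1.-tuple X -> \bar R).
Hypothesis mf : measurable_fun setT f.

Lemma measurable_uncons :
  measurable_fun [set: X * n.-tuple X] (fun p => f [tuple of p.1 :: p.2]).
Proof. exact: (measurableT_comp mf (@measurable_cons_pair n)). Qed.

Lemma measurable_cons_l y :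
  measurable_fun [set: n.-tuple X] (fun v => f [tuple of y :: v]).
Proof.
exact: (measurableT_comp measurable_uncons (pair1_measurable y)).
Qed.

End sections.

Lemma tuple_integralD n (f g : n.-tuple X -> \bar R) :
  (forall v, 0 <= f v) -> (forall v, 0 <= g v) ->
  measurable_fun setT f -> measurable_fun setT g ->
  TI (fun v => f v + g v) = TI f + TI g.
Proof.
elim: n f g => [//|n IH f g f0 g0 mf mg] /=.
rewrite -ge0_integralD//.
- by apply: eq_integral => y _; apply: IH => //; exact: measurable_cons_l.
- by move=> y _; exact: tuple_integral_ge0.
- by apply: measurable_tuple_integral => //; exact: measurable_uncons.
- by move=> y _; exact: tuple_integral_ge0.
- by apply: measurable_tuple_integral => //; exact: measurable_uncons.
Qed.

Lemma tuple_integralZl n (c : R) (f : n.-tuple X -> \bar R) :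
  (0 <= c)%R -> (forall v, 0 <= f v) -> measurable_fun setT f ->
  TI (fun v => c%:E * f v) = c%:E * TI f.
Proof.
move=> c0; elim: n f => [//|n IH f f0 mf] /=.
rewrite -integralZl_fin//.
- by apply: eq_integral => y _; apply: IH => //; exact: measurable_cons_l.
- by apply: measurable_tuple_integral => //; exact: measurable_uncons.
- by move=> y; exact: tuple_integral_ge0.
Qed.

Lemma fubini_tuple_integral d (T : measurableType d)
    (mu : {sigma_finite_measure set T -> \bar R}) n
    (F : T -> n.-tuple X -> \bar R) :
  (forall t v, 0 <= F t v) ->
  measurable_fun [set: T * n.-tuple X] (fun p => F p.1 p.2) ->
  \int[mu]_t TI (F t) = TI (fun v => \int[mu]_t F t v).
Proof.
elim: n F => [//|n IH F F0 mF] /=.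
have mF' : measurable_fun [set: (T * X) * n.-tuple X]
    (fun p => F p.1.1 [tuple of p.1.2 :: p.2]).
  apply: (measurableT_comp (f := fun p => F p.1 p.2)
    (g := fun p : (T * X) * n.-tuple X => (p.1.1, [tuple of p.1.2 :: p.2]))) => //.
  apply: measurable_fun_pair => /=.
    exact: (measurableT_comp measurable_fst).
  apply: measurable_cons => //.
  exact: (measurableT_comp measurable_snd).
rewrite (fubini_tonelli (fun p : T * X => TI (fun v => F p.1 [tuple of p.2 :: v])))/=.
- apply: eq_integral => y _; apply: IH => //.
  apply: (measurableT_comp mF' (g := fun p : T * n.-tuple X => ((p.1, y), p.2))).
  by apply: measurable_fun_pair => //; apply: measurable_fun_pair.
- exact: (measurable_tuple_integral (F := fun p v => F p.1 [tuple of p.2 :: v])).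
- by move=> p; exact: tuple_integral_ge0.
Qed.

Definition tset n (v : n.-tuple X) (i : nat) (y : X) : n.-tuple X :=
  [tuple if j == i :> nat then y else tnth v j | j < n].

Lemma tset0 n (v : n.-tuple X) x y :
  tset [tuple of x :: v] 0 y = [tuple of y :: v].
Proof.
apply: eq_from_tnth => j; rewrite tnth_mktuple.
by case: (unliftP ord0 j) => [j'|] -> /=; rewrite ?tnthS.
Qed.

Lemma tsetS n (v : n.-tuple X) x i y :
  tset [tuple of x :: v] i.+1 y = [tuple of x :: tset v i y].
Proof.
apply: eq_from_tnth => j; rewrite tnth_mktuple.
case: (unliftP ord0 j) => [j'|] -> //=.
by rewrite !tnthS tnth_mktuple /bump /= add1n eqSS.
Qed.

(** A product of copies of one measure is invariant under exchange of two coordinates, here the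
    [i]-th and the extra one. This is the change of variables that swaps the old and the new value
    of a record. *)
Lemma tuple_integral_swap n (i : 'I_n) (G : n.-tuple X -> X -> \bar R) :
  (forall v y, 0 <= G v y) ->
  measurable_fun [set: n.-tuple X * X] (fun p => G p.1 p.2) ->
  TI (fun v => \int[base_x M]_y G v y) =
  TI (fun v => \int[base_x M]_y G (tset v i y) (tnth v i)).
Proof.
elim: n i G => [[]//|n IH i G G0 mG] /=.
have mG' : measurable_fun [set: (X * n.-tuple X) * X]
    (fun p => G [tuple of p.1.1 :: p.1.2] p.2).
  apply: (measurableT_comp mG (g := fun p : (X * n.-tuple X) * X =>
    ([tuple of p.1.1 :: p.1.2], p.2))).
  apply: measurable_fun_pair => //=.
  exact: (measurableT_comp (@measurable_cons_pair n)).
case: (unliftP ord0 i) => [j|] ->.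
  apply: eq_integral => y0 _.
  rewrite (IH j) //.
    by congr TI; apply/funext => v; apply: eq_integral => y _; rewrite tsetS tnthS.
  apply: (measurableT_comp mG' (g := fun p : n.-tuple X * X => ((y0, p.1), p.2))).
  by apply: measurable_fun_pair => //; apply: measurable_fun_pair.
(* For the head coordinate, integrate the tail out: what remains is Tonelli for the two variables
   [y0] and [y]. *)
pose H y0 y := TI (fun v => G [tuple of y0 :: v] y).
have mH : measurable_fun [set: X * X] (fun p => H p.1 p.2).
  apply: (measurable_tuple_integral (F := fun p v => G [tuple of p.1 :: v] p.2)) => //=.
  apply: (measurableT_comp mG'
    (g := fun p : (X * X) * n.-tuple X => ((p.1.1, p.2), p.1.2))).
  apply: measurable_fun_pair; last exact: (measurableT_comp measurable_snd).
  by apply: measurable_fun_pair => //; exact: (measurableT_comp measurable_fst).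
have mGl y0 : measurable_fun [set: X * n.-tuple X]
    (fun p => G [tuple of y0 :: p.2] p.1).
  apply: (measurableT_comp mG' (g := fun p : X * n.-tuple X => ((y0, p.2), p.1))).
  by apply: measurable_fun_pair => //; apply: measurable_fun_pair.
have mGr y0 : measurable_fun [set: X * n.-tuple X]
    (fun p => G [tuple of p.1 :: p.2] y0).
  exact: (measurableT_comp mG' (g := fun p : X * n.-tuple X => (p, y0))).
transitivity (\int[base_x M]_y0 \int[base_x M]_y H y0 y).
  apply: eq_integral => y0 _; rewrite -(fubini_tuple_integral (base_x M)
    (F := fun y v => G [tuple of y0 :: v] y))//.
rewrite (fubini_tonelli (fun p => H p.1 p.2))//=; last first.
  by move=> p; exact: tuple_integral_ge0.
apply: eq_integral => y0 _.
rewrite (fubini_tuple_integral (base_x M) (F := fun y v => G [tuple of y :: v] y0))//.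
congr TI; apply/funext => v; apply: eq_integral => y _.
by rewrite tset0.
Qed.

(** The iterated integral peels off the head, whereas births and deaths act on the last record. *)
Lemma tuple_integral_rcons n (H : n.+1.-tuple X -> \bar R) :
  TI H = TI (fun v => \int[base_x M]_y H [tuple of rcons v y]).
Proof.
elim: n H => [H|n IH H] /=.
  by apply: eq_integral => y _; congr H; exact: val_inj.
apply: eq_integral => y0 _; rewrite -/tuple_integral.
rewrite -[LHS]/(TI (fun v => H [tuple of y0 :: v])) IH.
congr TI; apply/funext => v; apply: eq_integral => y _.
by congr H; exact: val_inj.
Qed.

End tuple_integral.

(** * Markov operators and Metropolis moves *)

Section nonneg_measurable.
Local Open Scope ereal_scope.
Context d (T : measurableType d) (R : realType).

Definition nnm (f : T -> \bar R) : Prop :=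
  measurable_fun [set: T] f /\ forall z, 0 <= f z.

Lemma nnm_cst (c : R) : (0 <= c)%R -> nnm (fun=> c%:E).
Proof. by move=> c0; split. Qed.

Lemma nnmD f g : nnm f -> nnm g -> nnm (fun z => f z + g z).
Proof.
move=> [mf f0] [mg g0]; split; first exact: emeasurable_funD.
by move=> z; exact: adde_ge0.
Qed.

Lemma nnmM f g : nnm f -> nnm g -> nnm (fun z => f z * g z).
Proof.
move=> [mf f0] [mg g0]; split; first exact: emeasurable_funM.
by move=> z; exact: mule_ge0.
Qed.

Lemma nnm_EFin (h : T -> R) : measurable_fun [set: T] h ->
  (forall z, (0 <= h z)%R) -> nnm (fun z => (h z)%:E).
Proof.
by move=> mh h0; split=> [|z]; [exact/measurable_EFinP|rewrite lee_fin].
Qed.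

Lemma nnm_comp d' (T' : measurableType d') (f : T -> \bar R) (g : T' -> T) :
  nnm f -> measurable_fun [set: T'] g ->
  measurable_fun [set: T'] (fun z => f (g z)) /\ forall z, 0 <= f (g z).
Proof. by move=> [mf f0] mg; split => //; exact: (measurableT_comp mf). Qed.

End nonneg_measurable.

Section markov_operators.
Local Open Scope ereal_scope.
Context (R : realType) dT dX (Theta : measurableType dT) (X : measurableType dX).
Local Notation st := (Theta * dataset X)%type.
Implicit Types (P Q : (st -> \bar R) -> st -> \bar R) (f g : st -> \bar R)
  (D : set nat).

(** An algebraic stand-in for a Markov kernel, stable under composition. Monotonicity is supplied
    separately by [size_closed]. *)
Definition markov_op P : Prop :=
  [/\ forall f, nnm f -> nnm (P f),
      forall f g, nnm f -> nnm g -> P (fun z => f z + g z) = (fun z => P f z + P g z) &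
      forall c : R, (0 <= c)%R -> P (fun=> c%:E) = (fun=> c%:E)].

(* [P] never leaves the sizes in [D]: on them, [P f] does not see [f] elsewhere. *)
Definition size_closed D P : Prop :=
  forall f g, nnm f -> nnm g ->
    (forall z : st, D (size_of z.2) -> f z <= g z) ->
    forall z : st, D (size_of z.2) -> P f z <= P g z.

Lemma markov_comp P Q : markov_op P -> markov_op Q -> markov_op (fun f => P (Q f)).
Proof.
move=> [P1 P2 P3] [Q1 Q2 Q3]; split => [f mf|f g mf mg|c c0].
- by apply: P1; exact: Q1.
- by rewrite Q2// P2//; exact: Q1.
- by rewrite Q3// P3.
Qed.

Lemma size_closed_comp D P Q : markov_op Q ->
  size_closed D P -> size_closed D Q -> size_closed D (fun f => P (Q f)).
Proof.
move=> [Q1 _ _] DP DQ f g mf mg fg.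
by apply: DP; [exact: Q1|exact: Q1|exact: DQ].
Qed.

Lemma markov_id : markov_op (fun f => f).
Proof. by split. Qed.

Lemma size_closed_id D : size_closed D (fun f => f).
Proof. by move=> f g _ _. Qed.

Lemma markov_iter P n : markov_op P -> markov_op (fun f => iter n P f).
Proof.
by move=> mP; elim: n => [|n IH]; [exact: markov_id|exact: (markov_comp mP IH)].
Qed.

Lemma size_closed_iter D P n : markov_op P -> size_closed D P ->
  size_closed D (fun f => iter n P f).
Proof.
move=> mP DP; elim: n => [|n IH]; first exact: size_closed_id.
exact: (size_closed_comp (markov_iter n mP) DP IH).
Qed.

Lemma markov_foldr (E : nat -> (st -> \bar R) -> st -> \bar R) l :
  (forall i, markov_op (E i)) -> markov_op (fun f => foldr E f l).
Proof.
by move=> mE; elim: l => [|i l IH]; [exact: markov_id|exact: (markov_comp (mE i) IH)].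
Qed.

Lemma size_closed_foldr D (E : nat -> (st -> \bar R) -> st -> \bar R) l :
  (forall i, markov_op (E i)) -> (forall i, size_closed D (E i)) ->
  size_closed D (fun f => foldr E f l).
Proof.
move=> mE DE; elim: l => [|i l IH]; first exact: size_closed_id.
exact: (size_closed_comp (markov_foldr l mE) (DE i) IH).
Qed.

Lemma size_closed_ge D P f (c : R) : markov_op P -> size_closed D P ->
  nnm f -> (0 <= c)%R -> (forall z : st, D (size_of z.2) -> c%:E <= f z) ->
  forall z : st, D (size_of z.2) -> c%:E <= P f z.
Proof.
move=> [_ _ Pc] DP mf c0 cf z Dz; have /= := DP _ _ (nnm_cst _ c0) mf cf z Dz.
by rewrite Pc.
Qed.

Lemma size_closed_le D P f (c : R) : markov_op P -> size_closed D P ->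
  nnm f -> (0 <= c)%R -> (forall z : st, D (size_of z.2) -> f z <= c%:E) ->
  forall z : st, D (size_of z.2) -> P f z <= c%:E.
Proof.
move=> [_ _ Pc] DP mf c0 cf z Dz; have /= := DP _ _ mf (nnm_cst _ c0) cf z Dz.
by rewrite Pc.
Qed.

End markov_operators.

Section moves.
Local Open Scope ereal_scope.
Context (R : realType) dT dX dS dN (Theta : measurableType dT)
  (X : measurableType dX) (S : measurableType dS) (N : measurableType dN)
  (V : nmodType) (M : model R Theta X S N V) (s : S) (ndp : N).
Local Notation st := (Theta * dataset X)%type.
Implicit Types (f g : st -> \bar R) (z : st).

Lemma accept_or_stay_ge0 (c : R) f z' z : (0 <= c <= 1)%R ->
  (forall w, 0 <= f w) -> 0 <= accept_or_stay c f z' z.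
Proof.
move=> /andP[c0 c1] f0; rewrite /accept_or_stay.
by apply: adde_ge0; apply: mule_ge0; rewrite ?lee_fin ?subr_ge0.
Qed.

Lemma accept_or_stayD (c : R) f g z' z : (0 <= c <= 1)%R ->
  (forall w, 0 <= f w) -> (forall w, 0 <= g w) ->
  accept_or_stay c (fun w => f w + g w) z' z =
  accept_or_stay c f z' z + accept_or_stay c g z' z.
Proof.
move=> /andP[c0 c1] f0 g0; rewrite /accept_or_stay.
by rewrite !ge0_muleDr// addeACA.
Qed.

Lemma accept_or_stay_cst (c k : R) z' z :
  accept_or_stay c (fun=> k%:E) z' z = k%:E :> \bar R.
Proof. by rewrite /accept_or_stay -!EFinM -EFinD -mulrDl addrC subrK mul1r. Qed.

(** The proposed state is compared only if it can be accepted. This lets the jump be monotone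
    relative to the supported sizes even when it proposes to leave them. *)
Lemma le_accept_or_stay (c : R) f g z' z : (0 <= c <= 1)%R ->
  (forall w, 0 <= f w) -> ((0 < c)%R -> f z' <= g z') -> f z <= g z ->
  accept_or_stay c f z' z <= accept_or_stay c g z' z.
Proof.
move=> /andP[c0 c1] f0 fg' fg; rewrite /accept_or_stay; apply: leeD; last first.
  by rewrite lee_wpmul2l// lee_fin subr_ge0.
have [->|cn0] := eqVneq c 0%R; first by rewrite !mul0e.
by rewrite lee_wpmul2l// fg'// lt0r cn0.
Qed.

Lemma accept_or_stay_accept (c k : R) f z' z : (0 <= k)%R -> (k <= c <= 1)%R ->
  (forall w, 0 <= f w) -> k%:E * f z' <= accept_or_stay c f z' z.
Proof.
move=> k0 /andP[kc c1] f0; rewrite /accept_or_stay -[leLHS]adde0.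
apply: leeD; first by rewrite lee_wpmul2r.
by rewrite mule_ge0// lee_fin subr_ge0.
Qed.

Section metropolis.
Variables (alpha : st -> X -> R) (phi : st -> X -> st).
Hypothesis alpha01 : forall z y, (0 <= alpha z y <= 1)%R.
Hypothesis malpha : measurable_fun [set: st * X] (fun p => alpha p.1 p.2).
Hypothesis mphi : measurable_fun [set: st * X] (fun p => phi p.1 p.2).

(** A common template: entry updates, births and, with acceptance probability 1, the exact
    refreshing of a record are all instances. *)
Definition metropolis f z : \bar R :=
  \int[base_x M]_y ((lik M z.1 y)%:E * accept_or_stay (alpha z y) f (phi z y) z).

Lemma nnm_metropolis_integrand f : nnm f -> nnm (fun p : st * X =>
  (lik M p.1.1 p.2)%:E * accept_or_stay (alpha p.1 p.2) f (phi p.1 p.2) p.1).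
Proof.
move=> nf; apply: nnmM.
  apply: nnm_EFin => [|p]; last exact: lik_ge0.
  apply: (measurableT_comp (measurable_lik M) (g := fun p : st * X => (p.1.1, p.2))).
  by apply: measurable_fun_pair => //; exact: (measurableT_comp measurable_fst).
apply: nnmD; apply: nnmM.
- by apply: nnm_EFin => // p; case/andP: (alpha01 p.1 p.2).
- exact: nnm_comp nf mphi.
- apply: nnm_EFin; first exact: measurable_funB.
  by move=> p; rewrite subr_ge0; case/andP: (alpha01 p.1 p.2).
- exact: nnm_comp nf measurable_fst.
Qed.

Lemma nnm_metropolis f : nnm f -> nnm (metropolis f).
Proof.
move=> /nnm_metropolis_integrand[mf f0]; split.
  apply: (measurable_parametric (base_x M) _ mf) => z y.
  exact: (f0 (z, y)).
by move=> z; apply: integral_ge0 => y _; exact: (f0 (z, y)).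
Qed.

Lemma metropolisD f g : nnm f -> nnm g ->
  metropolis (fun z => f z + g z) = (fun z => metropolis f z + metropolis g z).
Proof.
move=> nf ng; apply/funext => z; rewrite /metropolis.
have [mf f0] := nnm_metropolis_integrand nf.
have [mg g0] := nnm_metropolis_integrand ng.
rewrite -ge0_integralD//.
- apply: eq_integral => y _; rewrite accept_or_stayD//; [|exact: nf.2|exact: ng.2].
  by rewrite ge0_muleDr// accept_or_stay_ge0//; [exact: nf.2|exact: ng.2].
- by move=> y _; exact: (f0 (z, y)).
- exact: (measurableT_comp mf (pair1_measurable z)).
- by move=> y _; exact: (g0 (z, y)).
- exact: (measurableT_comp mg (pair1_measurable z)).
Qed.

Lemma measurable_lik_l th : measurable_fun [set: X] (lik M th).
Proof. exact: (measurableT_comp (measurable_lik M) (pair1_measurable th)). Qed.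

Lemma integral_lik_cst th (c : R) : (0 <= c)%R ->
  \int[base_x M]_y ((lik M th y)%:E * c%:E) = c%:E.
Proof.
move=> c0; rewrite ge0_integralZr// ?lik_int ?mul1e//.
  by apply/measurable_EFinP; exact: measurable_lik_l.
by move=> y _; rewrite lee_fin lik_ge0.
Qed.

Lemma metropolis_cst (c : R) : (0 <= c)%R ->
  metropolis (fun=> c%:E) = (fun=> c%:E).
Proof.
move=> c0; apply/funext => z; rewrite /metropolis.
by under eq_integral do rewrite accept_or_stay_cst; exact: integral_lik_cst.
Qed.

Lemma markov_metropolis : markov_op metropolis.
Proof.
split; [exact: nnm_metropolis|exact: metropolisD|exact: metropolis_cst].
Qed.

Lemma le_metropolis f g z : (forall w, 0 <= f w) ->
  (forall y, (0 < alpha z y)%R -> f (phi z y) <= g (phi z y)) -> f z <= g z ->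
  metropolis f z <= metropolis g z.
Proof.
move=> f0 fg' fg; apply: le_integral_nonneg => y.
  by rewrite mule_ge0 ?lee_fin ?lik_ge0// accept_or_stay_ge0.
rewrite lee_wpmul2l ?lee_fin ?lik_ge0//.
by apply: le_accept_or_stay => //; exact: fg'.
Qed.

Lemma metropolis_ge f z (k : R) : nnm f -> (0 <= k)%R ->
  (forall y, (k <= alpha z y)%R) ->
  k%:E * \int[base_x M]_y ((lik M z.1 y)%:E * f (phi z y)) <= metropolis f z.
Proof.
move=> nf k0 ka.
have [mf f0] : nnm (fun y => (lik M z.1 y)%:E * f (phi z y)).
  apply: nnmM.
    by apply: nnm_EFin => [|y]; [exact: measurable_lik_l|exact: lik_ge0].
  split; last by move=> y; exact: nf.2.
  apply: (measurableT_comp nf.1).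
  exact: (measurableT_comp mphi (pair1_measurable z)).
rewrite -integralZl_fin//; apply: le_integral_nonneg => y.
  by rewrite mule_ge0.
rewrite muleCA lee_wpmul2l ?lee_fin ?lik_ge0//.
apply: accept_or_stay_accept => //; last exact: nf.2.
by rewrite ka; case/andP: (alpha01 z y).
Qed.

End metropolis.

End moves.

(** * The moves of the algorithm *)

Section moves_markov.
Local Open Scope ereal_scope.
Context (R : realType) dT dX dS dN (Theta : measurableType dT)
  (X : measurableType dX) (S : measurableType dS) (N : measurableType dN)
  (V : nmodType) (M : model R Theta X S N V) (s : S) (ndp : N).
Local Notation st := (Theta * dataset X)%type.
Implicit Types (f g : st -> \bar R) (z : st) (x : dataset X).

Lemma size_append x y : size_of (append x y) = (size_of x).+1.
Proof. by []. Qed.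

(** The [maxn] reflects the default case of [remove_last], which keeps a dataset of size 1. *)
Lemma size_remove_last x : size_of (remove_last x) = maxn 1 (size_of x).-1.
Proof. by case: x => -[|k] v //; rewrite (maxn_idPr _). Qed.

Lemma measurable_mech_data : measurable_fun [set: dataset X] (fun x => mech M x s).
Proof. exact: (measurableT_comp (measurable_mech M) (pair2_measurable s)). Qed.

Lemma min1_01 (r : R) : (0 <= r -> 0 <= Num.min 1 r <= 1)%R.
Proof. by move=> r0; rewrite le_min ler01 r0 ge_min lexx. Qed.

Definition entry_accept i z (y : X) : R :=
  (Num.min 1 (mech M (set_entry z.2 i y) s / mech M z.2 s))%R.

Definition entry_target i z (y : X) : st := (z.1, set_entry z.2 i y).

Lemma entry_accept01 i z y : (0 <= entry_accept i z y <= 1)%R.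
Proof. by apply: min1_01; rewrite divr_ge0// mech_ge0. Qed.

Lemma measurable_set_entry_snd i : measurable_fun [set: st * X]
  (fun p => set_entry p.1.2 i p.2).
Proof.
apply: (measurableT_comp (@measurable_set_entry _ X i)
  (g := fun p : st * X => (p.2, p.1.2))).
by apply: measurable_fun_pair => //; exact: (measurableT_comp measurable_snd).
Qed.

Lemma measurable_entry_target i : measurable_fun [set: st * X]
  (fun p => entry_target i p.1 p.2).
Proof.
apply: measurable_fun_pair; last exact: measurable_set_entry_snd.
exact: (measurableT_comp measurable_fst).
Qed.

Lemma measurable_entry_accept i : measurable_fun [set: st * X]
  (fun p => entry_accept i p.1 p.2).
Proof.
apply: measurable_minr => //; apply: measurable_funM.
  exact: (measurableT_comp measurable_mech_data (@measurable_set_entry_snd i)).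
apply: measurable_invr_ge0 => [p|]; first exact: mech_ge0.
apply: (measurableT_comp measurable_mech_data (g := fun p : st * X => p.1.2)).
exact: (measurableT_comp measurable_snd).
Qed.

Lemma entry_moveE i : entry_move M s i = metropolis M (entry_accept i) (entry_target i).
Proof. by []. Qed.

Lemma markov_entry_move i : markov_op (entry_move M s i).
Proof.
rewrite entry_moveE; apply: markov_metropolis.
- exact: entry_accept01.
- exact: measurable_entry_accept.
- exact: measurable_entry_target.
Qed.

Lemma size_closed_entry_move D i : size_closed D (entry_move M s i).
Proof.
move=> f g nf ng fg z Dz; rewrite entry_moveE; apply: le_metropolis.
- exact: entry_accept01.
- exact: nf.2.
- by move=> y _; exact: fg.
- exact: fg.
Qed.

Lemma sweepE f k th (v : k.+1.-tuple X) :
  sweep M s f (th, mkdata v) = foldr (entry_move M s) f (iota 0 k.+1) (th, mkdata v).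
Proof. by []. Qed.

Lemma markov_sweep : markov_op (sweep M s).
Proof.
have mE l := markov_foldr l markov_entry_move.
split=> [f nf|f g nf ng|c c0].
- split.
    (* The number of updates varies with the size, so measurability is checked on each power of [X],
       where the list of indices is fixed. *)
    apply: measurable_fun_fibers => k; under eq_fun do rewrite sweepE.
    have [E1 _ _] := mE (iota 0 k.+1); have [mEf _] := E1 _ nf.
    apply: (measurableT_comp mEf
      (g := fun p : Theta * k.+1.-tuple X => (p.1, mkdata p.2))).
    apply: measurable_fun_pair => //.
    exact: (measurableT_comp (@measurable_mkdata _ _ k)).
  move=> z; have [E1 _ _] := mE (iota 0 (size_of z.2)).
  by have [_] := E1 _ nf; exact.
- apply/funext => z; have [_ E2 _] := mE (iota 0 (size_of z.2)).
  by rewrite /sweep E2.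
- apply/funext => z; have [_ _ E3] := mE (iota 0 (size_of z.2)).
  by rewrite /sweep E3.
Qed.

Lemma size_closed_sweep D : size_closed D (sweep M s).
Proof.
move=> f g nf ng fg z Dz; rewrite /sweep.
apply: (size_closed_foldr (D := D) _ markov_entry_move) => // i.
exact: size_closed_entry_move.
Qed.

Lemma size_proposal_ge0 m n : (0 <= size_proposal R m n)%R.
Proof.
rewrite /size_proposal; by case: ifP => // _; case: ifP.
Qed.

Lemma size_proposal_up n : (0 < n)%N ->
  size_proposal R n.+1 n = (if n == 1%N then 1 else 2^-1)%R.
Proof. by case: n => [//|[|n]] _; rewrite /size_proposal//= eqxx. Qed.

Lemma size_proposal_down n : (0 < n)%N ->
  size_proposal R n.-1 n = (if n == 1%N then 0 else 2^-1)%R.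
Proof. by case: n => [//|[|n]] _; rewrite /size_proposal//= eqxx orbT. Qed.

Lemma size_proposalD n : (0 < n)%N ->
  (size_proposal R n.+1 n + size_proposal R n.-1 n = 1)%R.
Proof.
move=> n0; rewrite size_proposal_up// size_proposal_down//.
by case: ifP => _; rewrite ?addr0// [RHS]splitr mul1r.
Qed.

(** Numerator and denominator of the acceptance ratio are this one function with its arguments
    exchanged, which exposes the symmetry behind detailed balance. *)
Definition jump_weight (x' x : dataset X) : R :=
  (prior_n M (size_of x') * mech M x' s * size_mech M (size_of x') ndp
        * size_proposal R (size_of x) (size_of x'))%R.

Lemma jump_weight_ge0 x' x : (0 <= jump_weight x' x)%R.
Proof.
by rewrite !mulr_ge0 ?prior_n_ge0 ?mech_ge0 ?size_mech_ge0 ?size_proposal_ge0.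
Qed.

Lemma jump_acceptE x' x :
  jump_accept M s ndp x' x = (Num.min 1 (jump_weight x' x / jump_weight x x'))%R.
Proof. by []. Qed.

Lemma jump_accept01 x' x : (0 <= jump_accept M s ndp x' x <= 1)%R.
Proof. by rewrite jump_acceptE; apply: min1_01; rewrite divr_ge0// jump_weight_ge0. Qed.

Lemma jump_accept_gt0 x' x : (0 < jump_accept M s ndp x' x)%R ->
  (0 < prior_n M (size_of x'))%R.
Proof.
move=> ja; rewrite lt0r prior_n_ge0 andbT; apply: contraTN ja => /eqP p0.
by rewrite jump_acceptE /jump_weight p0 !mul0r min_r ?ltxx.
Qed.

(** As the proposed size is a function [k] of the current one, all factors of the ratio except the
    mechanism densities are functions of the current size. *)
Lemma measurable_jump_accept d (T : measurableType d) (g h : T -> dataset X)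
    (k : nat -> nat) : (forall t, size_of (g t) = k (size_of (h t))) ->
  measurable_fun [set: T] g -> measurable_fun [set: T] h ->
  measurable_fun [set: T] (fun t => jump_accept M s ndp (g t) (h t)).
Proof.
move=> gh mg mh; apply: measurable_minr => //.
have size_h (c : nat -> R) : measurable_fun [set: T] (fun t => c (size_of (h t))).
  exact: (measurableT_comp (measurable_fun_size c) mh).
have mm (u : T -> dataset X) : measurable_fun [set: T] u ->
    measurable_fun [set: T] (fun t => mech M (u t) s).
  exact: (measurableT_comp measurable_mech_data).
apply: measurable_funM.
  under eq_fun do rewrite gh.
  apply: measurable_funM; last exact: (size_h (fun n => size_proposal R n (k n))).
  apply: measurable_funM; last exact: (size_h (fun n => size_mech M (k n) ndp)).
  apply: measurable_funM; first exact: (size_h (fun n => prior_n M (k n))).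
  exact: mm.
apply: measurable_invr_ge0 => [t|]; first exact: (jump_weight_ge0 (h t) (g t)).
under eq_fun do rewrite gh.
apply: measurable_funM; last exact: (size_h (fun n => size_proposal R (k n) n)).
apply: measurable_funM; last exact: (size_h (fun n => size_mech M n ndp)).
apply: measurable_funM; first exact: (size_h (prior_n M)).
exact: mm.
Qed.

Definition birth_accept z (y : X) : R := jump_accept M s ndp (append z.2 y) z.2.
Definition birth_target z (y : X) : st := (z.1, append z.2 y).

Definition birth : (st -> \bar R) -> st -> \bar R :=
  metropolis M birth_accept birth_target.

Definition death f z : \bar R :=
  accept_or_stay (jump_accept M s ndp (remove_last z.2) z.2) f
    (z.1, remove_last z.2) z.

Lemma jump_moveE f z : jump_move M s ndp f z =
  (size_proposal R (size_of z.2).+1 (size_of z.2))%:E * birth f z +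
  (size_proposal R (size_of z.2).-1 (size_of z.2))%:E * death f z.
Proof. by case: z. Qed.

Lemma measurable_append_snd : measurable_fun [set: st * X]
  (fun p => append p.1.2 p.2).
Proof.
apply: (measurableT_comp (@measurable_append _ X)
  (g := fun p : st * X => (p.2, p.1.2))).
by apply: measurable_fun_pair => //; exact: (measurableT_comp measurable_snd).
Qed.

Lemma measurable_birth_target : measurable_fun [set: st * X]
  (fun p => birth_target p.1 p.2).
Proof.
apply: measurable_fun_pair; last exact: measurable_append_snd.
exact: (measurableT_comp measurable_fst).
Qed.

Lemma measurable_birth_accept : measurable_fun [set: st * X]
  (fun p => birth_accept p.1 p.2).
Proof.
apply: (measurable_jump_accept (k := succn)) => //; first exact: measurable_append_snd.
exact: (measurableT_comp measurable_snd).
Qed.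

Lemma birth_accept01 z y : (0 <= birth_accept z y <= 1)%R.
Proof. exact: jump_accept01. Qed.

Lemma markov_birth : markov_op birth.
Proof.
apply: markov_metropolis.
- exact: birth_accept01.
- exact: measurable_birth_accept.
- exact: measurable_birth_target.
Qed.

Lemma nnm_death f : nnm f -> nnm (death f).
Proof.
move=> nf; have mr : measurable_fun [set: st] (fun z => remove_last z.2).
  exact: (measurableT_comp (@measurable_remove_last _ X)).
have ma : measurable_fun [set: st]
    (fun z => jump_accept M s ndp (remove_last z.2) z.2).
  by apply: (measurable_jump_accept (k := fun n => maxn 1 n.-1)) => // z;
    exact: size_remove_last.
apply: nnmD; apply: nnmM => //.
- by apply: nnm_EFin => // z; case/andP: (jump_accept01 (remove_last z.2) z.2).
- by apply: (nnm_comp nf); apply: measurable_fun_pair.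
- apply: nnm_EFin; first exact: measurable_funB.
  by move=> z; rewrite subr_ge0; case/andP: (jump_accept01 (remove_last z.2) z.2).
Qed.

Lemma markov_jump_move : markov_op (jump_move M s ndp).
Proof.
have [B1 B2 B3] := markov_birth.
split=> [f nf|f g nf ng|c c0]; last 2 first.
- apply/funext => z; rewrite !jump_moveE B2// /death accept_or_stayD//; last 3 first.
    exact: jump_accept01.
    exact: nf.2.
    exact: ng.2.
  rewrite (@ge0_muleDr _ _ (birth f z)) ?(B1 _ nf).2 ?(B1 _ ng).2//.
  rewrite (@ge0_muleDr _ _ (accept_or_stay _ f _ _)); last 2 first.
    by apply: accept_or_stay_ge0; [exact: jump_accept01|exact: nf.2].
    by apply: accept_or_stay_ge0; [exact: jump_accept01|exact: ng.2].
  by rewrite addeACA.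
- apply/funext => z; rewrite jump_moveE B3// /death accept_or_stay_cst.
  by rewrite -!EFinM -EFinD -mulrDl size_proposalD// mul1r.
rewrite (funext (jump_moveE f)).
have size_snd (c : nat -> R) : measurable_fun [set: st] (fun z => c (size_of z.2)).
  exact: (measurableT_comp (measurable_fun_size c)).
apply: nnmD; apply: nnmM.
- apply: nnm_EFin => [|z]; last exact: size_proposal_ge0.
  exact: (size_snd (fun n => size_proposal R n.+1 n)).
- exact: B1.
- apply: nnm_EFin => [|z]; last exact: size_proposal_ge0.
  exact: (size_snd (fun n => size_proposal R n.-1 n)).
- exact: nnm_death.
Qed.

Definition size_support : set nat := [set n | 0 < prior_n M n]%R.

Lemma size_closed_jump_move : size_closed size_support (jump_move M s ndp).
Proof.
move=> f g nf ng fg z Dz; rewrite !jump_moveE; apply: leeD.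
  rewrite lee_wpmul2l ?lee_fin ?size_proposal_ge0//; apply: le_metropolis.
  - exact: birth_accept01.
  - exact: nf.2.
  - by move=> y /jump_accept_gt0 pz; apply: fg; exact: pz.
  - exact: fg.
rewrite lee_wpmul2l ?lee_fin ?size_proposal_ge0//; apply: le_accept_or_stay.
- exact: jump_accept01.
- exact: nf.2.
- by move=> /jump_accept_gt0 pz; apply: fg; exact: pz.
- exact: fg.
Qed.

End moves_markov.

(** * The parameter draw and the full iteration *)

Section theta_move.
Local Open Scope ereal_scope.
Context (R : realType) dT dX dS dN (Theta : measurableType dT)
  (X : measurableType dX) (S : measurableType dS) (N : measurableType dN)
  (V : nmodType) (M : model R Theta X S N V) (s : S) (ndp : N).
Local Notation st := (Theta * dataset X)%type.
Implicit Types (f g : st -> \bar R) (z : st) (x : dataset X).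

Lemma lik_data_ge0 th x : (0 <= lik_data M th x)%R.
Proof. by apply: prodr_ge0 => y _; exact: lik_ge0. Qed.

Lemma measurable_lik_data :
  measurable_fun [set: st] (fun z => lik_data M z.1 z.2).
Proof.
apply: measurable_fun_fibers => k; rewrite /lik_data /records /=.
under eq_fun do rewrite big_tuple.
apply: measurable_prod => i _.
apply: (measurableT_comp (measurable_lik M)
  (g := fun p : Theta * k.+1.-tuple X => (p.1, tnth p.2 i))).
apply: measurable_fun_pair => //.
by apply: (measurableT_comp (@measurable_tnth _ X k.+1 i)).
Qed.

Lemma nnm_theta_weight : nnm (fun z => (prior M z.1 * lik_data M z.1 z.2)%:E).
Proof.
apply: nnm_EFin => [|z]; last by rewrite mulr_ge0 ?prior_ge0 ?lik_data_ge0.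
apply: measurable_funM; last exact: measurable_lik_data.
exact: (measurableT_comp (measurable_prior M)).
Qed.

Lemma nnm_section f x : nnm f -> nnm (fun th => f (th, x)).
Proof. by move=> nf; exact: (nnm_comp nf (pair2_measurable x)). Qed.

Definition theta_evidence x : \bar R :=
  \int[base_theta M]_th (prior M th * lik_data M th x)%:E.

Variables (a B : R).
Hypothesis a_gt0 : (0 < a)%R.
Hypothesis lik_gea : forall th y, (a <= lik M th y)%R.
Hypothesis lik_leB : forall th y, (lik M th y <= B)%R.
Hypothesis prior_int : \int[base_theta M]_th (prior M th)%:E = 1.

Lemma lik_bound_gt0 : (0 < B)%R.
Proof. exact: lt_le_trans a_gt0 (le_trans (lik_gea point point) (lik_leB _ _)). Qed.

Lemma lik_data_ge th x : (a ^+ size_of x <= lik_data M th x)%R.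
Proof.
case: x => k v; rewrite /lik_data /records /= big_tuple /size_of /=.
rewrite -[X in (_ ^+ X)%R](card_ord k.+1) -prodr_const.
by apply: ler_prod => i _; rewrite (ltW a_gt0) lik_gea.
Qed.

Lemma lik_data_le th x : (lik_data M th x <= B ^+ size_of x)%R.
Proof.
case: x => k v; rewrite /lik_data /records /= big_tuple /size_of /=.
rewrite -[X in (_ ^+ X)%R](card_ord k.+1) -prodr_const.
by apply: ler_prod => i _; rewrite lik_ge0 lik_leB.
Qed.

Lemma nnm_prior : nnm (fun th => (prior M th)%:E).
Proof. by apply: nnm_EFin; [exact: measurable_prior|exact: prior_ge0]. Qed.

Lemma integral_prior_cst (c : R) : (0 <= c)%R ->
  \int[base_theta M]_th ((prior M th)%:E * c%:E) = c%:E.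
Proof.
move=> c0; rewrite ge0_integralZr// ?prior_int ?mul1e//.
  exact: nnm_prior.1.
by move=> th _; rewrite lee_fin prior_ge0.
Qed.

(** Since the prior has total mass 1, pointwise bounds on the likelihood become bounds on the
    normalizing constant. The latter is thus positive and finite, so that [fine] and the inverse in
    [theta_move] have their intended meaning. *)
Lemma theta_evidence_ge x : (a ^+ size_of x)%:E <= theta_evidence x.
Proof.
rewrite -[leLHS]integral_prior_cst ?exprn_ge0 ?(ltW a_gt0)//.
apply: le_integral_nonneg => th.
  by rewrite -EFinM lee_fin mulr_ge0 ?prior_ge0 ?exprn_ge0 ?(ltW a_gt0).
by rewrite -EFinM lee_fin ler_wpM2l ?prior_ge0 ?lik_data_ge.
Qed.

Lemma theta_evidence_le x : theta_evidence x <= (B ^+ size_of x)%:E.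
Proof.
rewrite -[leRHS]integral_prior_cst ?exprn_ge0 ?(ltW lik_bound_gt0)//.
apply: le_integral_nonneg => th.
  by rewrite lee_fin mulr_ge0 ?prior_ge0 ?lik_data_ge0.
by rewrite -EFinM lee_fin ler_wpM2l ?prior_ge0 ?lik_data_le.
Qed.

Lemma theta_evidence_fin x : theta_evidence x \is a fin_num.
Proof.
rewrite ge0_fin_numE; first exact: le_lt_trans (theta_evidence_le x) (ltry _).
by apply: le_trans (theta_evidence_ge x); rewrite lee_fin exprn_ge0// ltW.
Qed.

Lemma fine_theta_evidence_gt0 x : (0 < fine (theta_evidence x))%R.
Proof.
rewrite -lte_fin fineK ?theta_evidence_fin//.
by apply: lt_le_trans (theta_evidence_ge x); rewrite lte_fin exprn_gt0.
Qed.

Lemma theta_moveE f z : theta_move M f z =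
  (fine (theta_evidence z.2))^-1%:E * \int[base_theta M]_th
    ((prior M th * lik_data M th z.2)%:E * f (th, z.2)).
Proof. by []. Qed.

Lemma nnm_theta_integrand f x : nnm f ->
  nnm (fun th => (prior M th * lik_data M th x)%:E * f (th, x)).
Proof.
move=> nf; apply: nnmM; last exact: nnm_section.
exact: (nnm_section x nnm_theta_weight).
Qed.

Lemma theta_evidence_inv_ge0 x : (0 <= (fine (theta_evidence x))^-1)%R.
Proof. by rewrite invr_ge0 ltW// fine_theta_evidence_gt0. Qed.

Lemma nnm_theta_inner f : nnm f -> nnm (fun x : dataset X =>
  \int[base_theta M]_th ((prior M th * lik_data M th x)%:E * f (th, x))).
Proof.
move=> nf; split; last first.
  by move=> x; apply: integral_ge0 => th _; exact: (nnm_theta_integrand x nf).2.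
apply: (measurable_parametric (base_theta M)) => [x th|].
  exact: (nnm_theta_integrand x nf).2.
have [mw _] := nnmM nnm_theta_weight nf.
apply: (measurableT_comp mw (g := fun p : dataset X * Theta => (p.2, p.1))).
exact: measurable_fun_pair.
Qed.

Lemma measurable_theta_evidence_inv :
  measurable_fun [set: dataset X] (fun x => (fine (theta_evidence x))^-1%R).
Proof.
apply: measurable_invr_ge0 => [x|]; first exact: ltW (fine_theta_evidence_gt0 x).
apply: measurableT_comp => //.
have [m1 _] := nnm_theta_inner (nnm_cst st (@ler01 R)).
rewrite (_ : theta_evidence = fun x => \int[base_theta M]_th
  ((prior M th * lik_data M th x)%:E * 1)) //.
by apply/funext => x; apply: eq_integral => th _; rewrite mule1.
Qed.

Lemma markov_theta_move : markov_op (theta_move M).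
Proof.
split=> [f nf|f g nf ng|c c0].
- apply: (nnmM (f := fun z : st => (fine (theta_evidence z.2))^-1%:E)).
    apply: nnm_EFin => [|z]; last exact: theta_evidence_inv_ge0.
    exact: (measurableT_comp measurable_theta_evidence_inv).
  exact: (nnm_comp (nnm_theta_inner nf) measurable_snd).
- apply/funext => z; rewrite !theta_moveE -ge0_muleDr; last 2 first.
    exact: (nnm_theta_inner nf).2.
    exact: (nnm_theta_inner ng).2.
  congr (_ * _); rewrite -ge0_integralD//; last 4 first.
    by move=> th _; exact: (nnm_theta_integrand z.2 nf).2.
    exact: (nnm_theta_integrand z.2 nf).1.
    by move=> th _; exact: (nnm_theta_integrand z.2 ng).2.
    exact: (nnm_theta_integrand z.2 ng).1.
  by apply: eq_integral => th _; rewrite ge0_muleDr ?nf.2 ?ng.2.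
- apply/funext => z; rewrite theta_moveE ge0_integralZr//; last 2 first.
    exact: (nnm_section z.2 nnm_theta_weight).1.
    by move=> th _; exact: (nnm_section z.2 nnm_theta_weight).2.
  rewrite -/(theta_evidence z.2) -{2}(fineK (theta_evidence_fin z.2)).
  by rewrite muleA -EFinM mulVf ?mul1r// gt_eqF// fine_theta_evidence_gt0.
Qed.

Lemma size_closed_theta_move D : size_closed D (theta_move M).
Proof.
move=> f g nf ng fg z Dz; rewrite !theta_moveE.
rewrite lee_wpmul2l ?lee_fin ?theta_evidence_inv_ge0//.
apply: le_integral_nonneg => th; first exact: (nnm_theta_integrand z.2 nf).2.
rewrite lee_wpmul2l//; last exact: fg.
exact: (nnm_section z.2 nnm_theta_weight).2.
Qed.

(** The powers of [a] bound the likelihood in the numerator, those of [B] the normalizing constant.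
    The resulting factor sees the data only through its size. *)
Lemma theta_move_ge f z : nnm f ->
  ((a / B) ^+ size_of z.2)%:E *
    \int[base_theta M]_th ((prior M th)%:E * f (th, z.2)) <= theta_move M f z.
Proof.
move=> nf; rewrite theta_moveE; set n := size_of z.2.
have npf : nnm (fun th => (prior M th)%:E * f (th, z.2)).
  by apply: nnmM; [exact: nnm_prior|exact: nnm_section].
have an0 : (0 <= a ^+ n)%R by rewrite exprn_ge0// ltW.
rewrite expr_div_n mulrC EFinM -muleA; apply: lee_pmul.
- by rewrite lee_fin invr_ge0 exprn_ge0// ltW// lik_bound_gt0.
- by rewrite mule_ge0 ?lee_fin//; apply: integral_ge0 => th _; exact: npf.2.
- rewrite lee_fin lef_pV2 ?posrE ?fine_theta_evidence_gt0 ?exprn_gt0 ?lik_bound_gt0//.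
  by rewrite -lee_fin fineK ?theta_evidence_fin// theta_evidence_le.
rewrite -integralZl_fin//; last 2 first.
- exact: npf.1.
- exact: npf.2.
apply: le_integral_nonneg => th; first by rewrite mule_ge0 ?npf.2.
rewrite muleA lee_wpmul2r ?nf.2// -EFinM lee_fin mulrC ler_wpM2l ?prior_ge0//.
exact: lik_data_ge.
Qed.

Lemma markov_iteration : markov_op (iteration M s ndp).
Proof.
apply: (markov_comp markov_theta_move).
exact: (markov_comp (markov_sweep M s) (markov_jump_move M s ndp)).
Qed.

Lemma size_closed_iteration : size_closed (size_support M) (iteration M s ndp).
Proof.
apply: size_closed_comp; last 2 first.
- exact: size_closed_theta_move.
- apply: (size_closed_comp (markov_jump_move M s ndp)).
    exact: size_closed_sweep.
  exact: size_closed_jump_move.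
- exact: (markov_comp (markov_sweep M s) (markov_jump_move M s ndp)).
Qed.

End theta_move.

(** * Stationarity of the posterior *)

Section invariance.
Local Open Scope ereal_scope.
Context (R : realType) dT dX dS dN (Theta : measurableType dT)
  (X : measurableType dX) (S : measurableType dS) (N : measurableType dN)
  (V : nmodType) (M : model R Theta X S N V) (s : S) (ndp : N).
Local Notation st := (Theta * dataset X)%type.
Local Notation TI := (tuple_integral M).
Local Notation J := (joint_density M s ndp).
Implicit Types (f g h : st -> \bar R) (z : st) (x : dataset X).

Definition size_integral k h : \bar R :=
  \int[base_theta M]_th TI (fun v : k.+1.-tuple X => h (th, mkdata v)).

Lemma state_integralE h :
  state_integral M h = \sum_(0 <= k <oo) size_integral k h.
Proof. by []. Qed.

Lemma nnm_fiber k h : nnm h ->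
  nnm (fun p : Theta * k.+1.-tuple X => h (p.1, mkdata p.2)).
Proof.
move=> nh; apply: (nnm_comp nh); apply: measurable_fun_pair => //.
exact: (measurableT_comp (@measurable_mkdata _ _ k)).
Qed.

Lemma nnm_fiber_th k h th : nnm h ->
  nnm (fun v : k.+1.-tuple X => h (th, mkdata v)).
Proof. by move=> /(@nnm_fiber k) nh; exact: (nnm_comp nh (pair1_measurable th)). Qed.

Lemma nnm_fiber_integral k h : nnm h ->
  nnm (fun th => TI (fun v : k.+1.-tuple X => h (th, mkdata v))).
Proof.
move=> /(@nnm_fiber k) [mh h0]; split.
  by apply: measurable_tuple_integral => // th v; exact: (h0 (th, v)).
by move=> th; apply: tuple_integral_ge0 => v; exact: (h0 (th, v)).
Qed.

Lemma size_integral_ge0 k h : (forall z, 0 <= h z) -> 0 <= size_integral k h.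
Proof. by move=> h0; apply: integral_ge0 => th _; exact: tuple_integral_ge0. Qed.

Lemma le_size_integral k g h : (forall z, 0 <= g z) ->
  (forall z, g z <= h z) -> size_integral k g <= size_integral k h.
Proof.
move=> g0 gh; apply: le_integral_nonneg => th; first exact: tuple_integral_ge0.
exact: le_tuple_integral.
Qed.

Lemma size_integralD k g h : nnm g -> nnm h ->
  size_integral k (fun z => g z + h z) = size_integral k g + size_integral k h.
Proof.
move=> ng nh; rewrite /size_integral.
have [mg g0] := nnm_fiber_integral k ng; have [mh h0] := nnm_fiber_integral k nh.
rewrite -ge0_integralD//; apply: eq_integral => th _.
have [? ?] := nnm_fiber_th k th ng; have [? ?] := nnm_fiber_th k th nh.
by rewrite tuple_integralD.
Qed.

Lemma le_state_integral g h : (forall z, 0 <= g z) ->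
  (forall z, g z <= h z) -> state_integral M g <= state_integral M h.
Proof.
move=> g0 gh; apply: lee_nneseries => [k _ _|k _]; first exact: size_integral_ge0.
exact: le_size_integral.
Qed.

Lemma state_integralD g h : nnm g -> nnm h ->
  state_integral M (fun z => g z + h z) = state_integral M g + state_integral M h.
Proof.
move=> ng nh; rewrite !state_integralE -nneseriesD.
- by apply: eq_eseriesr => k _; exact: size_integralD.
- by move=> k _ _; apply: size_integral_ge0 => z; exact: ng.2.
- by move=> k _ _; apply: size_integral_ge0 => z; exact: nh.2.
Qed.

Lemma joint_density_ge0 z : (0 <= J z)%R.
Proof.
by rewrite /joint_density !mulr_ge0 ?prior_ge0 ?prior_n_ge0 ?lik_data_ge0
  ?mech_ge0 ?size_mech_ge0.
Qed.

Lemma measurable_joint_density : measurable_fun [set: st] J.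
Proof.
have size_snd (c : nat -> R) : measurable_fun [set: st] (fun z => c (size_of z.2)).
  exact: (measurableT_comp (measurable_fun_size c)).
apply: measurable_funM; last exact: (size_snd (fun n => size_mech M n ndp)).
apply: measurable_funM; last first.
  exact: (measurableT_comp (measurable_mech_data M s)).
apply: measurable_funM; last exact: measurable_lik_data.
apply: measurable_funM; last exact: (size_snd (prior_n M)).
exact: (measurableT_comp (measurable_prior M)).
Qed.

Lemma nnm_joint_density : nnm (fun z => (J z)%:E).
Proof.
by apply: nnm_EFin; [exact: measurable_joint_density|exact: joint_density_ge0].
Qed.

(** Stated for the unnormalized density; finiteness and positivity of the evidence enter only when
    [posterior] is evaluated. *)
Definition stationary (P : (st -> \bar R) -> st -> \bar R) : Prop :=
  forall f, nnm f -> state_integral M (fun z => (J z)%:E * P f z) =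
                     state_integral M (fun z => (J z)%:E * f z).

Lemma stationary_comp P Q : markov_op Q ->
  stationary P -> stationary Q -> stationary (fun f => P (Q f)).
Proof. by move=> [Q1 _ _] sP sQ f nf; rewrite sP ?sQ//; exact: Q1. Qed.

Section theta.
Variables (a B : R).
Hypothesis a_gt0 : (0 < a)%R.
Hypothesis lik_gea : forall th y, (a <= lik M th y)%R.
Hypothesis lik_leB : forall th y, (lik M th y <= B)%R.
Hypothesis prior_int : \int[base_theta M]_th (prior M th)%:E = 1.

(** The move is a conditional expectation given the dataset. Tonelli brings the integral over the
    parameter innermost, where the dataset is fixed. *)
Lemma stationary_theta_move : stationary (theta_move M).
Proof.
move=> f nf; apply: eq_eseriesr => k _.
have swapE h : nnm h -> size_integral k h =
    TI (fun v : k.+1.-tuple X => \int[base_theta M]_th h (th, mkdata v)).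
  move=> /(@nnm_fiber k) [mh h0].
  by apply: (fubini_tuple_integral M (base_theta M)
      (F := fun th v => h (th, mkdata v))) => // th v;
    exact: (h0 (th, v)).
have [mT _ _] := markov_theta_move a_gt0 lik_gea lik_leB prior_int.
rewrite -[LHS]/(size_integral k (fun z => (J z)%:E * theta_move M f z)).
rewrite -[RHS]/(size_integral k (fun z => (J z)%:E * f z)).
rewrite swapE; last exact: nnmM nnm_joint_density (mT _ nf).
rewrite swapE; last exact: nnmM nnm_joint_density nf.
congr TI; apply/funext => v; set x := mkdata v.
(* The factors of the joint density that do not involve the parameter. *)
set c := (prior_n M (size_of x) * mech M x s * size_mech M (size_of x) ndp)%R.
have c0 : (0 <= c)%R by rewrite /c !mulr_ge0 ?prior_n_ge0 ?mech_ge0 ?size_mech_ge0.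
have JE th : (J (th, x))%:E = c%:E * (prior M th * lik_data M th x)%:E.
  by rewrite -EFinM; congr EFin; rewrite /joint_density /c /=; ring.
set I := \int[base_theta M]_th ((prior M th * lik_data M th x)%:E * f (th, x)).
have I0 : 0 <= I.
  by apply: integral_ge0 => th _; exact: (nnm_theta_integrand M x nf).2.
transitivity (c%:E * I).
  (* The new parameter ignores the old one, so integrating out the old one produces the normalizing
     constant, which cancels. *)
  under eq_integral do rewrite theta_moveE /= -/I JE -!muleA.
  have [mw w0] := nnm_section x (nnm_theta_weight M).
  have i0 := theta_evidence_inv_ge0 a_gt0 lik_gea lik_leB prior_int x.
  rewrite integralZl_fin//; last 2 first.
  - by apply: emeasurable_funM => //; exact: mw.
  - by move=> th; rewrite mule_ge0 ?w0// mule_ge0.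
  rewrite ge0_integralZr//; [|by move=> th _; exact: w0|by rewrite mule_ge0].
  rewrite -/(theta_evidence M x).
  rewrite -{1}(fineK (theta_evidence_fin a_gt0 lik_gea lik_leB prior_int x)).
  rewrite [X in _ * X]muleA -EFinM divff ?mul1e// gt_eqF//.
  exact: fine_theta_evidence_gt0 a_gt0 lik_gea lik_leB prior_int x.
rewrite /I -integralZl_fin//; last 2 first.
- exact: (nnm_theta_integrand M x nf).1.
- exact: (nnm_theta_integrand M x nf).2.
by apply: eq_integral => th _; rewrite JE muleA.
Qed.

End theta.

(** The Metropolis identity: the right-hand side is symmetric in [b] and [c], whence detailed
    balance. At [b = 0] both sides are 0, whatever the value given to the quotient. *)
Lemma mul_min_ratio (b c : R) : (0 <= b)%R -> (0 <= c)%R ->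
  (b * Num.min 1 (c / b) = Num.min b c)%R.
Proof.
rewrite le_eqVlt => /predU1P[<-|b0] c0; first by rewrite mul0r min_l.
by rewrite minr_pMr ?ltW// mulr1 mulrCA divff ?mulr1// gt_eqF.
Qed.

Section entry.

Lemma mkdata_tset k (v : k.+1.-tuple X) i y :
  set_entry (mkdata v) i y = mkdata (tset v i y).
Proof. by []. Qed.

Lemma tset_tset k (v : k.-tuple X) (i : 'I_k) y :
  tset (tset v i y) i (tnth v i) = v.
Proof.
apply: eq_from_tnth => j; rewrite !tnth_mktuple.
by case: eqP => // /val_inj ->.
Qed.

Lemma tnth_tset k (v : k.-tuple X) (i : 'I_k) y : tnth (tset v i y) i = y.
Proof. by rewrite tnth_mktuple eqxx. Qed.

Lemma lik_data_tset k th (v : k.+1.-tuple X) (i : 'I_k.+1) y :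
  (lik_data M th (mkdata (tset v i y)) * lik M th (tnth v i) =
   lik_data M th (mkdata v) * lik M th y)%R.
Proof.
have lE (u : k.+1.-tuple X) : lik_data M th (mkdata u) =
    (lik M th (tnth u i) * \prod_(j < k.+1 | j != i) lik M th (tnth u j))%R.
  by rewrite /lik_data /records big_tuple; exact: bigD1.
rewrite !lE tnth_tset (eq_bigr (fun j => lik M th (tnth v j))); first by ring.
by move=> j ji; rewrite tnth_mktuple ifN.
Qed.

(** The proposal density equals the likelihood factor of the replaced record, so on both sides the
    likelihood terms coincide and only the mechanism densities have to be balanced. *)
Lemma entry_balance k th (v : k.+1.-tuple X) (i : 'I_k.+1) y :
  (J (th, mkdata (tset v i y)) * lik M th (tnth v i) *
     entry_accept M s i (th, mkdata (tset v i y)) (tnth v i) =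
   J (th, mkdata v) * lik M th y * entry_accept M s i (th, mkdata v) y)%R.
Proof.
rewrite /entry_accept /joint_density /= !mkdata_tset tset_tset.
have size_tset : size_of (mkdata (tset v i y)) = size_of (mkdata v) by [].
rewrite size_tset; set v' := mkdata (tset v i y); set x := mkdata v.
set p := prior M th; set q := prior_n M _; set r := size_mech M _ _.
transitivity (p * q * r * (lik_data M th v' * lik M th (tnth v i)) *
   (mech M v' s * Num.min 1 (mech M x s / mech M v' s)))%R; first by ring.
rewrite lik_data_tset mul_min_ratio ?mech_ge0// minC -mul_min_ratio ?mech_ge0//.
by rewrite -/x; ring.
Qed.

Let entry_part (w : st * X -> R) f (phi : st * X -> st) k th :
  measurable_fun setT w -> (forall p, 0 <= w p)%R -> nnm f ->
  measurable_fun setT phi ->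
  nnm (fun p : k.+1.-tuple X * X =>
    (w ((th, mkdata p.1), p.2))%:E * f (phi ((th, mkdata p.1), p.2))).
Proof.
move=> mw w0 nf mphi.
have nwf := nnmM (nnm_EFin mw w0) (nnm_comp nf mphi).
apply: (nnm_comp nwf (g := fun p : k.+1.-tuple X * X => ((th, mkdata p.1), p.2))).
apply: measurable_fun_pair => //; apply: measurable_fun_pair => //.
exact: (measurableT_comp (@measurable_mkdata _ _ k)).
Qed.

Lemma nnm_integral_part k (h : k.+1.-tuple X * X -> \bar R) : nnm h ->
  nnm (fun v => \int[base_x M]_y h (v, y)).
Proof.
move=> [mh h0]; split; last by move=> v; apply: integral_ge0 => y _; exact: h0.
apply: (measurable_parametric (base_x M) (f := fun v y => h (v, y))) => //.
by under eq_fun do rewrite -surjective_pairing.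
Qed.

(** The left side is split into accepted mass ([moved]) and rejected mass ([rest]). Detailed balance
    trades [moved] for [balanced], where [f] is read at the old state, and the parts are added up
    again without any subtraction. *)
Lemma tuple_integral_entry_move f k th (i : 'I_k.+1) : nnm f ->
  TI (fun v : k.+1.-tuple X =>
    (J (th, mkdata v))%:E * entry_move M s i f (th, mkdata v)) =
  TI (fun v : k.+1.-tuple X => (J (th, mkdata v))%:E * f (th, mkdata v)).
Proof.
move=> nf; set alpha := entry_accept M s (i : nat).
have ma : measurable_fun [set: st * X] (fun p => alpha p.1 p.2).
  exact: measurable_entry_accept.
have a01 z y : (0 <= alpha z y <= 1)%R by exact: entry_accept01.
have mJl : measurable_fun [set: st * X] (fun p => J p.1 * lik M p.1.1 p.2)%R.
  apply: measurable_funM.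
    exact: (measurableT_comp measurable_joint_density).
  apply: (measurableT_comp (measurable_lik M) (g := fun p : st * X => (p.1.1, p.2))).
  by apply: measurable_fun_pair => //; exact: (measurableT_comp measurable_fst).
have Jl0 z y : (0 <= J z * lik M z.1 y)%R by rewrite mulr_ge0 ?joint_density_ge0 ?lik_ge0.
pose w z y := (J z * lik M z.1 y * alpha z y)%R.
pose w' z y := (J z * lik M z.1 y * (1 - alpha z y))%R.
have mw : measurable_fun [set: st * X] (fun p => w p.1 p.2) by exact: measurable_funM.
have mw' : measurable_fun [set: st * X] (fun p => w' p.1 p.2).
  by apply: measurable_funM => //; exact: measurable_funB.
have w0 (p : st * X) : (0 <= w p.1 p.2)%R.
  by rewrite mulr_ge0//; case/andP: (a01 p.1 p.2).
have w'0 (p : st * X) : (0 <= w' p.1 p.2)%R.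
  by rewrite mulr_ge0// subr_ge0; case/andP: (a01 p.1 p.2).
pose x (v : k.+1.-tuple X) : st := (th, mkdata v).
pose moved v y := (w (x v) y)%:E * f (x (tset v i y)).
pose balanced v y := (w (x v) y)%:E * f (x v).
pose rest v y := (w' (x v) y)%:E * f (x v).
have nmoved : nnm (fun p : k.+1.-tuple X * X => moved p.1 p.2).
  exact: (entry_part k th mw w0 nf (measurable_entry_target (i : nat))).
have nbalanced : nnm (fun p : k.+1.-tuple X * X => balanced p.1 p.2).
  exact: (entry_part k th mw w0 nf measurable_fst).
have nrest : nnm (fun p : k.+1.-tuple X * X => rest p.1 p.2).
  exact: (entry_part k th mw' w'0 nf measurable_fst).
have sec (h : k.+1.-tuple X -> X -> \bar R) v :
    nnm (fun p : k.+1.-tuple X * X => h p.1 p.2) -> nnm (h v).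
  by move=> nh; exact: (nnm_comp nh (pair1_measurable v)).
have sum_parts (h : k.+1.-tuple X -> X -> \bar R)
    (nh : nnm (fun p : k.+1.-tuple X * X => h p.1 p.2)) :
    TI (fun v => \int[base_x M]_y (h v y + rest v y)) =
    TI (fun v => \int[base_x M]_y h v y) + TI (fun v => \int[base_x M]_y rest v y).
  have [mi i0] := nnm_integral_part nh; have [mr r0] := nnm_integral_part nrest.
  rewrite -tuple_integralD//; congr TI; apply/funext => v.
  have [? ?] := sec _ v nh; have [? ?] := sec _ v nrest.
  by rewrite -ge0_integralD.
transitivity (TI (fun v => \int[base_x M]_y (moved v y + rest v y))).
  congr TI; apply/funext => v; rewrite -/(x v) entry_moveE /metropolis.
  have [mi i0] := nnm_metropolis_integrand M a01 ma
    (measurable_entry_target (i : nat)) nf.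
  rewrite -integralZl_fin ?joint_density_ge0//; last 2 first.
  - exact: (measurableT_comp mi (pair1_measurable (x v))).
  - by move=> y; exact: (i0 (x v, y)).
  apply: eq_integral => y _; rewrite /accept_or_stay -/alpha muleA -EFinM.
  have := a01 (x v) y => /andP[al0 al1].
  rewrite ge0_muleDr; last 2 first.
  - by rewrite mule_ge0 ?lee_fin// nf.2.
  - by rewrite mule_ge0 ?lee_fin ?subr_ge0// nf.2.
  by rewrite !muleA -!EFinM.
(* Exchange the old and the new value of record [i]; by balance the weight does not change. *)
rewrite sum_parts//; have -> : TI (fun v => \int[base_x M]_y moved v y) =
    TI (fun v => \int[base_x M]_y balanced v y).
  rewrite (tuple_integral_swap M i) => [|v y|];
    [|exact: (nmoved.2 (v, y))|exact: nmoved.1].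
  congr TI; apply/funext => v; apply: eq_integral => y _.
  by rewrite /moved /w entry_balance tset_tset.
rewrite -sum_parts//; congr TI; apply/funext => v.
(* Acceptance and rejection probabilities add up to 1, and the proposal density integrates to 1. *)
transitivity (\int[base_x M]_y ((lik M th y)%:E * ((J (x v))%:E * f (x v)))).
  apply: eq_integral => y _; rewrite /balanced /rest -ge0_muleDl; last 2 first.
  - by rewrite lee_fin (w0 (x v, y)).
  - by rewrite lee_fin (w'0 (x v, y)).
  rewrite -EFinD muleA -EFinM; congr (EFin _ * _).
  by rewrite /w /w' /=; ring.
rewrite ge0_integralZr//; last 3 first.
- by apply/measurable_EFinP; exact: measurable_lik_l.
- by move=> y _; rewrite lee_fin lik_ge0.
- by rewrite mule_ge0 ?nf.2// lee_fin joint_density_ge0.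
by rewrite lik_int mul1e.
Qed.

(** A sweep in fixed order need not be reversible, but each update preserves the integral at fixed
    parameter and size, and this survives composition. *)
Lemma stationary_sweep : stationary (sweep M s).
Proof.
move=> f nf; apply: eq_eseriesr => k _; apply: eq_integral => th _.
rewrite -[LHS]/(TI (fun v : k.+1.-tuple X => (J (th, mkdata v))%:E *
  foldr (entry_move M s) f (iota 0 k.+1) (th, mkdata v))).
have : all (fun i => i < k.+1)%N (iota 0 k.+1).
  by apply/allP => i; rewrite mem_iota.
elim: (iota 0 k.+1) => [//|i l IH] /= /andP[ik lk].
have [E1 _ _] := markov_foldr l (markov_entry_move M s).
exact: etrans (tuple_integral_entry_move th (Ordinal ik) (E1 _ nf)) (IH lk).
Qed.

End entry.

End invariance.

(** * Balance of births and deaths *)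

Section jump_invariance.
Local Open Scope ereal_scope.
Context (R : realType) dT dX dS dN (Theta : measurableType dT)
  (X : measurableType dX) (S : measurableType dS) (N : measurableType dN)
  (V : nmodType) (M : model R Theta X S N V) (s : S) (ndp : N).
Local Notation st := (Theta * dataset X)%type.
Local Notation TI := (tuple_integral M).
Local Notation J := (joint_density M s ndp).
Local Notation accept := (jump_accept M s ndp).
Local Notation q_up z := (size_proposal R (size_of z.2).+1 (size_of z.2)).
Local Notation q_down z := (size_proposal R (size_of z.2).-1 (size_of z.2)).
Implicit Types (f g h : st -> \bar R) (z : st) (x : dataset X).

Local Arguments append : simpl never.
Local Arguments remove_last : simpl never.

Lemma lik_data_append th x y :
  (lik_data M th (append x y) = lik_data M th x * lik M th y)%R.
Proof. by rewrite /lik_data /records /= big_rcons /= mulrC. Qed.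

Lemma remove_last_append x y : remove_last (append x y) = x.
Proof.
case: x => k v; rewrite /remove_last /append /=; congr existT.
apply: eq_from_tnth => j; rewrite tnth_mktuple !(tnth_nth y) /=.
by rewrite nth_rcons size_tuple ltn_ord.
Qed.

(** The flows carry the mass of accepted proposals, the rests that of rejected ones. After
    integration over [y], the four weights add up to [J z]. *)
Definition birth_flow z (y : X) : R :=
  (J z * q_up z * lik M z.1 y * accept (append z.2 y) z.2)%R.

Definition death_flow z : R := (J z * q_down z * accept (remove_last z.2) z.2)%R.

Definition birth_rest z (y : X) : R :=
  (J z * q_up z * lik M z.1 y * (1 - accept (append z.2 y) z.2))%R.

Definition death_rest z : R :=
  (J z * q_down z * (1 - accept (remove_last z.2) z.2))%R.

Lemma jump_balance z y : birth_flow z y = death_flow (z.1, append z.2 y).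
Proof.
case: z => th x; rewrite /birth_flow /death_flow /= remove_last_append.
(* The proposal density of the new record is also its likelihood factor in the longer dataset. Hence
   both directions share the factor [c], and no Jacobian appears in the change of dimension. *)
set c := (prior M th * lik_data M th x * lik M th y)%R.
have JE : (J (th, x) * size_proposal R (size_of x).+1 (size_of x) * lik M th y =
    c * jump_weight M s ndp x (append x y))%R.
  by rewrite /joint_density /jump_weight /c size_append /=; ring.
have JE' : (J (th, append x y) * size_proposal R (size_of x) (size_of x).+1 =
    c * jump_weight M s ndp (append x y) x)%R.
  by rewrite /joint_density /jump_weight /c lik_data_append size_append /=; ring.
rewrite JE size_append /= JE' !jump_acceptE.
have := jump_weight_ge0 M s ndp x (append x y).
have := jump_weight_ge0 M s ndp (append x y) x.
move: (jump_weight _ _ _ x _) (jump_weight _ _ _ _ x) => u v v0 u0.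
by rewrite -2!(mulrA c) !mul_min_ratio// minC.
Qed.

Lemma birth_weight_ge0 z y : (0 <= J z * q_up z * lik M z.1 y)%R.
Proof.
exact: mulr_ge0 (mulr_ge0 (joint_density_ge0 M s ndp z) (size_proposal_ge0 R _ _))
  (lik_ge0 M _ _).
Qed.

Lemma death_weight_ge0 z : (0 <= J z * q_down z)%R.
Proof. exact: mulr_ge0 (joint_density_ge0 M s ndp z) (size_proposal_ge0 R _ _). Qed.

Lemma birth_flow_ge0 z y : (0 <= birth_flow z y)%R.
Proof.
apply: mulr_ge0; first exact: birth_weight_ge0.
by case/andP: (jump_accept01 M s ndp (append z.2 y) z.2).
Qed.

Lemma birth_rest_ge0 z y : (0 <= birth_rest z y)%R.
Proof.
apply: mulr_ge0; first exact: birth_weight_ge0.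
by rewrite subr_ge0; case/andP: (jump_accept01 M s ndp (append z.2 y) z.2).
Qed.

Lemma death_flow_ge0 z : (0 <= death_flow z)%R.
Proof.
apply: mulr_ge0; first exact: death_weight_ge0.
by case/andP: (jump_accept01 M s ndp (remove_last z.2) z.2).
Qed.

Lemma death_rest_ge0 z : (0 <= death_rest z)%R.
Proof.
apply: mulr_ge0; first exact: death_weight_ge0.
by rewrite subr_ge0; case/andP: (jump_accept01 M s ndp (remove_last z.2) z.2).
Qed.

Let measurable_size_snd (c : nat -> R) :
  measurable_fun [set: st] (fun z => c (size_of z.2)).
Proof. exact: (measurableT_comp (measurable_fun_size c)). Qed.

Let measurable_Jq : measurable_fun [set: st * X]
  (fun p => J p.1 * q_up p.1 * lik M p.1.1 p.2)%R.
Proof.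
apply: measurable_funM.
  apply: (measurableT_comp (f := fun z => J z * q_up z)%R) => //.
  apply: measurable_funM; first exact: measurable_joint_density.
  exact: (measurable_size_snd (fun n => size_proposal R n.+1 n)).
apply: (measurableT_comp (measurable_lik M) (g := fun p : st * X => (p.1.1, p.2))).
by apply: measurable_fun_pair => //; exact: (measurableT_comp measurable_fst).
Qed.

Lemma nnm_birth_flow : nnm (fun p : st * X => (birth_flow p.1 p.2)%:E).
Proof.
apply: nnm_EFin => [|p]; last exact: birth_flow_ge0.
by apply: measurable_funM => //; exact: (measurable_birth_accept M s ndp).
Qed.

Lemma nnm_birth_rest : nnm (fun p : st * X => (birth_rest p.1 p.2)%:E).
Proof.
apply: nnm_EFin => [|p]; last exact: birth_rest_ge0.
apply: measurable_funM => //; apply: measurable_funB => //.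
exact: (measurable_birth_accept M s ndp).
Qed.

Let measurable_death_accept :
  measurable_fun [set: st] (fun z => accept (remove_last z.2) z.2).
Proof.
apply: (measurable_jump_accept M s ndp (k := fun n => maxn 1 n.-1)) => // [z|].
  exact: size_remove_last.
exact: (measurableT_comp (@measurable_remove_last _ X)).
Qed.

Let measurable_Jq_down : measurable_fun [set: st] (fun z => J z * q_down z)%R.
Proof.
apply: measurable_funM; first exact: measurable_joint_density.
exact: (measurable_size_snd (fun n => size_proposal R n.-1 n)).
Qed.

Lemma nnm_death_flow : nnm (fun z => (death_flow z)%:E).
Proof.
by apply: nnm_EFin => [|z]; [exact: measurable_funM|exact: death_flow_ge0].
Qed.

Lemma nnm_death_rest : nnm (fun z => (death_rest z)%:E).
Proof.
apply: nnm_EFin => [|z]; last exact: death_rest_ge0.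
by apply: measurable_funM => //; exact: measurable_funB.
Qed.

Lemma nnm_integral_snd (w : st * X -> \bar R) : nnm w ->
  nnm (fun z => \int[base_x M]_y w (z, y)).
Proof.
move=> [mw w0]; split; last by move=> z; apply: integral_ge0 => y _; exact: w0.
apply: (measurable_parametric (base_x M) (f := fun z y => w (z, y))) => //.
by under eq_fun do rewrite -surjective_pairing.
Qed.

(** In the [moved] parts [f] is read after the jump, in the [kept] parts before it. The expansions
    of [J] times the jump of [f] and of [J] times [f] share [jump_stay], so stationarity reduces to
    matching flows. *)
Definition up_moved f z :=
  \int[base_x M]_y ((birth_flow z y)%:E * f (z.1, append z.2 y)).
Definition up_kept f z := \int[base_x M]_y ((birth_flow z y)%:E * f z).
Definition down_moved f z := (death_flow z)%:E * f (z.1, remove_last z.2).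
Definition down_kept f z := (death_flow z)%:E * f z.
Definition jump_stay f z :=
  \int[base_x M]_y ((birth_rest z y)%:E * f z) + (death_rest z)%:E * f z.

Section parts.
Variable f : st -> \bar R.
Hypothesis nf : nnm f.

Lemma nnm_birth_target : nnm (fun p : st * X => f (birth_target p.1 p.2)).
Proof. exact: (nnm_comp nf (@measurable_birth_target _ _ Theta X)). Qed.

Lemma nnm_up_moved : nnm (up_moved f).
Proof. exact: (nnm_integral_snd (nnmM nnm_birth_flow nnm_birth_target)). Qed.

Lemma nnm_up_kept : nnm (up_kept f).
Proof.
exact: (nnm_integral_snd (nnmM nnm_birth_flow (nnm_comp nf measurable_fst))).
Qed.

Lemma nnm_down_moved : nnm (down_moved f).
Proof.
apply: nnmM; first exact: nnm_death_flow.
apply: (nnm_comp nf); apply: measurable_fun_pair => //.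
exact: (measurableT_comp (@measurable_remove_last _ X)).
Qed.

Lemma nnm_down_kept : nnm (down_kept f).
Proof. by apply: nnmM => //; exact: nnm_death_flow. Qed.

Lemma nnm_jump_stay : nnm (jump_stay f).
Proof.
apply: nnmD; last by apply: nnmM => //; exact: nnm_death_rest.
exact: (nnm_integral_snd (nnmM nnm_birth_rest (nnm_comp nf measurable_fst))).
Qed.

Let nnm_at (w : st * X -> \bar R) z : nnm w -> nnm (fun y => w (z, y)).
Proof. by move=> nw; exact: (nnm_comp nw (pair1_measurable z)). Qed.

Lemma scale_accept_or_stay (c alpha : R) z' z : (0 <= c)%R -> (0 <= alpha <= 1)%R ->
  c%:E * accept_or_stay alpha f z' z =
  (c * alpha)%:E * f z' + (c * (1 - alpha))%:E * f z.
Proof.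
move=> c0 /andP[al0 al1]; rewrite /accept_or_stay ge0_muleDr; last 2 first.
- by rewrite mule_ge0 ?nf.2.
- by rewrite mule_ge0 ?nf.2 ?lee_fin ?subr_ge0.
by rewrite !muleA -!EFinM.
Qed.

Lemma jump_move_parts z :
  (J z)%:E * jump_move M s ndp f z = up_moved f z + down_moved f z + jump_stay f z.
Proof.
have [B1 _ _] := markov_birth M s ndp.
have J0 := joint_density_ge0 M s ndp z.
have qu0 := size_proposal_ge0 R (size_of z.2).+1 (size_of z.2).
have qd0 := size_proposal_ge0 R (size_of z.2).-1 (size_of z.2).
have [mi i0] := nnm_metropolis_integrand M (birth_accept01 M s ndp)
  (measurable_birth_accept M s ndp) (@measurable_birth_target _ _ Theta X) nf.
rewrite jump_moveE ge0_muleDr; last 2 first.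
- by rewrite mule_ge0 ?(B1 _ nf).2.
- by rewrite mule_ge0 ?(nnm_death M s ndp nf).2.
rewrite addeACA !muleA -!EFinM; congr (_ + _); last first.
  by rewrite /death scale_accept_or_stay ?death_weight_ge0 ?jump_accept01.
have [m1 f1] := nnm_at z (nnmM nnm_birth_flow nnm_birth_target).
have [m2 f2] := nnm_at z (nnmM nnm_birth_rest (nnm_comp nf measurable_fst)).
rewrite /up_moved -ge0_integralD//; [|by move=> y _; exact: f1|by move=> y _; exact: f2].
rewrite /birth /metropolis -integralZl_fin; last 3 first.
- exact: (measurableT_comp mi (pair1_measurable z)).
- by move=> y; exact: (i0 (z, y)).
- exact: mulr_ge0.
apply: eq_integral => y _; rewrite muleA -EFinM.
by rewrite scale_accept_or_stay ?birth_weight_ge0 ?birth_accept01.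
Qed.

Lemma jump_kept_parts z :
  (J z)%:E * f z = up_kept f z + down_kept f z + jump_stay f z.
Proof.
have f0 := nf.2.
rewrite addeACA; have -> : down_kept f z + (death_rest z)%:E * f z =
    (J z * q_down z)%:E * f z.
  rewrite -ge0_muleDl ?lee_fin ?death_flow_ge0 ?death_rest_ge0// -EFinD.
  by congr (EFin _ * _); rewrite /death_flow /death_rest; ring.
have [m1 f1] := nnm_at z (nnmM nnm_birth_flow (nnm_comp nf measurable_fst)).
have [m2 f2] := nnm_at z (nnmM nnm_birth_rest (nnm_comp nf measurable_fst)).
have Jq0 : (0 <= J z * q_up z)%R.
  exact: mulr_ge0 (joint_density_ge0 M s ndp z) (size_proposal_ge0 R _ _).
rewrite /up_kept -ge0_integralD//; [|by move=> y _; exact: f1|by move=> y _; exact: f2].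
transitivity ((J z * q_up z)%:E * f z + (J z * q_down z)%:E * f z).
  rewrite -ge0_muleDl ?lee_fin ?death_weight_ge0// -EFinD -mulrDr.
  by rewrite size_proposalD ?mulr1.
congr (_ + _).
transitivity (\int[base_x M]_y ((lik M z.1 y)%:E * ((J z * q_up z)%:E * f z))).
  rewrite ge0_integralZr//; last 3 first.
  - by apply/measurable_EFinP; exact: measurable_lik_l.
  - by move=> y _; rewrite lee_fin lik_ge0.
  - by rewrite mule_ge0.
  by rewrite lik_int mul1e.
apply: eq_integral => y _; rewrite -ge0_muleDl; last 2 first.
- by rewrite lee_fin birth_flow_ge0.
- by rewrite lee_fin birth_rest_ge0.
rewrite -EFinD muleA -EFinM; congr (EFin _ * _).
by rewrite /birth_flow /birth_rest; ring.
Qed.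

(** The record proposed at size [k.+1] becomes the last record at size [k.+2]; both integrals run
    over the same variables, and the weights agree by [jump_balance]. *)
Lemma up_moved_down_kept k :
  size_integral M k (up_moved f) = size_integral M k.+1 (down_kept f).
Proof.
apply: eq_integral => th _; rewrite [RHS]tuple_integral_rcons.
congr TI; apply/funext => v; apply: eq_integral => y _.
by rewrite jump_balance.
Qed.

Lemma up_kept_down_moved k :
  size_integral M k (up_kept f) = size_integral M k.+1 (down_moved f).
Proof.
apply: eq_integral => th _; rewrite [RHS]tuple_integral_rcons.
congr TI; apply/funext => v; apply: eq_integral => y _.
by rewrite jump_balance -[RHS]/(down_moved f (th, append (mkdata v) y)) /down_moved /=
  remove_last_append.
Qed.

(** Shifting the index matches births out of each size with deaths out of the next one; the only
    unmatched term, deaths out of size 1, vanishes. *)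
Lemma death_flow_size1 th (v : 1.-tuple X) : death_flow (th, mkdata v) = 0%R.
Proof. by rewrite /death_flow (@size_proposal_down R 1)// mulr0 mul0r. Qed.

End parts.

Lemma size_integral_eq0 k h : (forall th (v : k.+1.-tuple X), h (th, mkdata v) = 0) ->
  size_integral M k h = 0.
Proof.
move=> h0; have TI0 n : TI (fun _ : n.-tuple X => 0) = 0 :> \bar R.
  elim: n => [//|n IH] /=.
  by rewrite (eq_integral (fun=> 0)) ?integral0// => y _; rewrite IH.
rewrite /size_integral (eq_integral (fun=> 0)) ?integral0// => th _.
by rewrite -(TI0 k.+1); congr TI; apply/funext => v; exact: h0.
Qed.

Lemma nneseries_shift (u : nat -> \bar R) : (forall k, 0 <= u k) -> u 0%N = 0 ->
  \sum_(0 <= k <oo) u k.+1 = \sum_(0 <= k <oo) u k.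
Proof.
move=> u0 u00; rewrite [RHS]nneseries_recl// u00 add0e.
by rewrite -(@nneseries_addn _ u 1%N)//; apply: eq_eseriesr => k _; rewrite addn1.
Qed.

(* The flow of births out of size [n] is the flow of deaths out of size [n + 1],
   so the two flows cancel after summation over the sizes. *)
Lemma stationary_jump_move : stationary M s ndp (jump_move M s ndp).
Proof.
move=> f nf.
have nUm := nnm_up_moved nf; have nUk := nnm_up_kept nf.
have nDm := nnm_down_moved nf; have nDk := nnm_down_kept nf.
have nS := nnm_jump_stay nf.
have eU : state_integral M (up_moved f) = state_integral M (down_kept f).
  rewrite [LHS]state_integralE [RHS]state_integralE -[RHS]nneseries_shift.
  - by apply: eq_eseriesr => k _; exact: up_moved_down_kept.
  - by move=> k; apply: size_integral_ge0 => z; exact: nDk.2.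
  - apply: size_integral_eq0 => th v.
    by rewrite /down_kept death_flow_size1 mul0e.
have eD : state_integral M (up_kept f) = state_integral M (down_moved f).
  rewrite [LHS]state_integralE [RHS]state_integralE -[RHS]nneseries_shift.
  - by apply: eq_eseriesr => k _; exact: up_kept_down_moved.
  - by move=> k; apply: size_integral_ge0 => z; exact: nDm.2.
  - apply: size_integral_eq0 => th v.
    by rewrite /down_moved death_flow_size1 mul0e.
transitivity (state_integral M
    (fun z => up_moved f z + down_moved f z + jump_stay f z)).
  by congr state_integral; apply/funext => z; exact: jump_move_parts.
transitivity (state_integral M
    (fun z => up_kept f z + down_kept f z + jump_stay f z)); last first.
  by congr state_integral; apply/funext => z; rewrite -jump_kept_parts.
rewrite (state_integralD M (nnmD nUm nDm) nS) (state_integralD M nUm nDm).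
rewrite (state_integralD M (nnmD nUk nDk) nS) (state_integralD M nUk nDk).
have exchange (b c d e r : \bar R) : b = e -> d = c -> b + c + r = d + e + r.
  by move=> -> ->; rewrite (addeC e).
exact: exchange eU eD.
Qed.

End jump_invariance.

(** * Minorization *)

Section minorization.
Local Open Scope ereal_scope.
Context (R : realType) dT dX dS dN (Theta : measurableType dT)
  (X : measurableType dX) (S : measurableType dS) (N : measurableType dN)
  (V : nmodType) (M : model R Theta X S N V) (s : S) (ndp : N).
Local Notation st := (Theta * dataset X)%type.
Implicit Types (f g h : st -> \bar R) (z : st) (x : dataset X).

Section comparison.
Variable eps : R.
Hypothesis mech_gt0 : forall x, (0 < mech M x s)%R.
Hypothesis mech_dp : dp_density (@neighbor X) eps (mech M).

Let mech_seq (l : seq X) : R := mech_g M s (\sum_(y <- l) mech_t M s y)%R.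

Let mech_seqE x : mech M x s = mech_seq (records x).
Proof. by []. Qed.

Let data_of y (l : seq X) : dataset X := mkdata [tuple of y :: in_tuple l].

Let kappa : R := expR (- eps).

Let mech_seq_cons y y' l :
  (kappa * mech_seq [:: y, y' & l] <= mech_seq (y' :: l))%R /\
  (kappa * mech_seq (y' :: l) <= mech_seq [:: y, y' & l])%R.
Proof.
rewrite -[mech_seq (y' :: l)]/(mech M (data_of y' l) s).
rewrite -[mech_seq [:: y, y' & l]]/(mech M (data_of y (y' :: l)) s).
have rem : one_removed (data_of y (y' :: l)) (data_of y' l).
  by exists [::], y, (y' :: l).
rewrite /kappa expRN; split; rewrite mulrC ler_pdivrMr ?expR_gt0// mulrC.
  by apply: mech_dp; left.
by apply: mech_dp; right.
Qed.

Let kappa_ge0 : (0 <= kappa)%R. Proof. exact: expR_ge0. Qed.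

(** One use of differential privacy per prepended record. The tail is kept nonempty because
    neighbors are nonempty datasets. *)
Let mech_seq_cat l y' l' :
  (kappa ^+ size l * mech_seq (l ++ y' :: l') <= mech_seq (y' :: l'))%R /\
  (kappa ^+ size l * mech_seq (y' :: l') <= mech_seq (l ++ y' :: l'))%R.
Proof.
elim: l => [|y l [IH1 IH2]] /=; first by rewrite expr0 !mul1r.
case E : (l ++ y' :: l') IH1 IH2 => [|w t] IH1 IH2; first by case: l E {IH1 IH2}.
have [c1 c2] := mech_seq_cons y w t; split.
- apply: le_trans IH1; rewrite exprSr -mulrA.
  by rewrite ler_wpM2l// exprn_ge0.
- by apply: le_trans c2; rewrite exprS -mulrA ler_wpM2l.
Qed.

(* The statistic is additive, hence blind to the order of concatenation:
   compare both datasets with their concatenation. *)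
Lemma mech_comparable x x' :
  (expR (- eps) ^+ (size_of x + size_of x') * mech M x' s <= mech M x s)%R.
Proof.
have sizeE (w : dataset X) : size_of w = size (records w).
  by case: w => k v; rewrite /records size_tuple.
rewrite !mech_seqE !sizeE.
have [y [l ->]] : exists y l, records x = y :: l.
  by case: x => k v; rewrite /records /=; case: (tupleP v) => y t; exists y, t.
have [y' [l' ->]] : exists y l, records x' = y :: l.
  by case: x' => k v; rewrite /records /=; case: (tupleP v) => y' t; exists y', t.
rewrite -/kappa.
have [_ c1] := mech_seq_cat (y :: l) y' l'.
have [c2 _] := mech_seq_cat (y' :: l') y l.
apply: le_trans c2; rewrite addnC exprD -mulrA ler_wpM2l ?exprn_ge0//.
apply: le_trans c1 _; rewrite le_eqVlt; apply/orP; left; apply/eqP.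
rewrite /mech_seq !big_cat /=; congr mech_g; exact: addrC.
Qed.

Lemma mech_ratio_ge x x' :
  (expR (- eps) ^+ (size_of x + size_of x') <= mech M x s / mech M x' s)%R.
Proof. by rewrite ler_pdivlMr// mech_comparable. Qed.

End comparison.

Definition refresh (i : nat) : (st -> \bar R) -> st -> \bar R :=
  metropolis M (fun _ _ => 1%R) (entry_target i).

Lemma refreshE i f z : refresh i f z =
  \int[base_x M]_y ((lik M z.1 y)%:E * f (z.1, set_entry z.2 i y)).
Proof.
apply: eq_integral => y _; congr (_ * _).
by rewrite /accept_or_stay subrr mul0e adde0 mul1e.
Qed.

Lemma one_accept01 : (0 <= (1 : R) <= 1)%R.
Proof. by rewrite ler01 lexx. Qed.

Lemma markov_refresh i : markov_op (refresh i).
Proof.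
apply: markov_metropolis => //; first by move=> _ _; exact: one_accept01.
exact: measurable_entry_target.
Qed.

Lemma size_closed_refresh D i : size_closed D (refresh i).
Proof.
move=> f g nf ng fg z Dz; apply: le_metropolis.
- by move=> _ _; exact: one_accept01.
- exact: nf.2.
- by move=> y _; exact: fg.
- exact: fg.
Qed.

Definition refresh_all n f : st -> \bar R := foldr refresh f (iota 0 n).

Lemma markov_refresh_all n : markov_op (refresh_all n).
Proof. exact: markov_foldr markov_refresh. Qed.

(** A record with index in [l] is overwritten before [f] is evaluated, so its old value cannot
    matter. *)
Lemma foldr_refresh_eq f l k th (v v' : k.+1.-tuple X) :
  (forall j : 'I_k.+1, (j : nat) \notin l -> tnth v j = tnth v' j) ->
  foldr refresh f l (th, mkdata v) = foldr refresh f l (th, mkdata v').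
Proof.
elim: l v v' => [|i l IH] v v' vv'.
  by congr (f (_, mkdata _)); apply: eq_from_tnth => j; exact: vv'.
rewrite /= !refreshE; apply: eq_integral => y _ /=.
rewrite !mkdata_tset; congr (_ * _); apply: IH => j jl.
rewrite !tnth_mktuple; case: eqP => // /eqP ji.
by apply: vv'; rewrite inE negb_or ji.
Qed.

Lemma refresh_all_eq f k th (v v' : k.+1.-tuple X) :
  refresh_all k.+1 f (th, mkdata v) = refresh_all k.+1 f (th, mkdata v').
Proof. by apply: foldr_refresh_eq => j; rewrite mem_iota leq0n add0n ltn_ord. Qed.

Lemma nnm_lik_mul f (phi : X -> st) th : nnm f -> measurable_fun setT phi ->
  nnm (fun y => (lik M th y)%:E * f (phi y)).
Proof.
move=> nf mphi; apply: nnmM; last exact: nnm_comp nf mphi.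
by apply: nnm_EFin => [|y]; [exact: measurable_lik_l|exact: lik_ge0].
Qed.

Lemma measurable_entry_target_at i z :
  measurable_fun [set: X] (fun y => (z.1, set_entry z.2 i y)).
Proof.
exact: (measurableT_comp (@measurable_entry_target _ _ _ X i) (pair1_measurable z)).
Qed.

Lemma refreshZ i (c : R) f z : (0 <= c)%R -> nnm f ->
  refresh i (fun w => c%:E * f w) z = c%:E * refresh i f z.
Proof.
move=> c0 nf; rewrite !refreshE.
have [mi i0] := nnm_lik_mul z.1 nf (measurable_entry_target_at i z).
by rewrite -integralZl_fin//; apply: eq_integral => y _; rewrite muleCA.
Qed.

Lemma nnmZ (c : R) f : (0 <= c)%R -> nnm f -> nnm (fun w => c%:E * f w).
Proof. by move=> c0 nf; exact: nnmM (nnm_cst _ c0) nf. Qed.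

Lemma foldr_refreshZ l (c : R) f z : (0 <= c)%R -> nnm f ->
  foldr refresh (fun w => c%:E * f w) l z = c%:E * foldr refresh f l z.
Proof.
move=> c0 nf; elim: l z => [//|i l IH] z /=.
have [E1 _ _] := markov_foldr l markov_refresh.
by rewrite -refreshZ//; [congr refresh; apply/funext => w; exact: IH|exact: E1].
Qed.

Variables (a B eps : R).
Hypothesis a_gt0 : (0 < a)%R.
Hypothesis lik_gea : forall th y, (a <= lik M th y)%R.
Hypothesis lik_leB : forall th y, (lik M th y <= B)%R.
Hypothesis prior_int : \int[base_theta M]_th (prior M th)%:E = 1.
Hypothesis mech_gt0 : forall x, (0 < mech M x s)%R.
Hypothesis mech_dp : dp_density (@neighbor X) eps (mech M).
Hypothesis size_mech_gt0 : forall n, (0 < n)%N -> (0 < size_mech M n ndp)%R.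

(** The exponent is the sum of the sizes before and after, as in [mech_ratio_ge], and an update
    keeps the size. The minimum with 1 makes this a valid lower bound for an acceptance probability
    whatever the sign of [eps]. *)
Let entry_rate n : R := (Num.min 1 (expR (- eps) ^+ (n + n)))%R.

Let entry_rate_gt0 n : (0 < entry_rate n)%R.
Proof. by rewrite lt_min ltr01 exprn_gt0// expR_gt0. Qed.

Lemma entry_move_ge i f z : nnm f ->
  (entry_rate (size_of z.2))%:E * refresh i f z <= entry_move M s i f z.
Proof.
move=> nf; rewrite entry_moveE refreshE.
apply: (metropolis_ge M (@entry_accept01 _ _ _ _ _ Theta X S N V M s i)
  (@measurable_entry_target _ _ Theta X i) nf (ltW (entry_rate_gt0 _))).
move=> y; rewrite /entry_rate /entry_accept le_min ge_min lexx /=.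
rewrite ge_min; apply/orP; right.
exact: (mech_ratio_ge mech_gt0 mech_dp (set_entry z.2 i y) z.2).
Qed.

Lemma foldr_entry_move_ge l f z : nnm f ->
  (entry_rate (size_of z.2) ^+ size l)%:E * foldr refresh f l z <=
  foldr (entry_move M s) f l z.
Proof.
move=> nf; elim: l z => [|i l IH] z /=; first by rewrite expr0 mul1e.
have [E1 _ _] := markov_foldr l (markov_entry_move M s).
have [F1 _ _] := markov_foldr l markov_refresh.
set c := entry_rate _; have c0 : (0 <= c)%R by exact: ltW (entry_rate_gt0 _).
have cl0 : (0 <= c ^+ size l)%R by rewrite exprn_ge0.
apply: le_trans (entry_move_ge i z (E1 _ nf)).
rewrite exprS EFinM -muleA lee_wpmul2l// -refreshZ//; last exact: F1.
(* The rate depends only on the size, which refreshing preserves, so the comparison is made on that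
   single size. *)
apply: (size_closed_refresh (D := [set size_of z.2])) => //.
- by apply: nnmZ => //; exact: F1.
- exact: E1.
- by move=> w /= wz; rewrite /c -wz; exact: IH.
Qed.

Lemma sweep_ge f z : nnm f ->
  (entry_rate (size_of z.2) ^+ size_of z.2)%:E * refresh_all (size_of z.2) f z <=
  sweep M s f z.
Proof.
move=> nf; have := foldr_entry_move_ge (iota 0 (size_of z.2)) z nf.
by rewrite size_iota.
Qed.

Lemma size_proposal_up_ge n : (0 < n)%N -> (2^-1 <= size_proposal R n.+1 n)%R.
Proof.
move=> n0; rewrite size_proposal_up//; case: ifP => // _.
by rewrite invf_le1// ler1n.
Qed.

Lemma jump_move_ge_birth f z : nnm f ->
  (2^-1)%:E * birth M s ndp f z <= jump_move M s ndp f z.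
Proof.
move=> nf; have [B1 _ _] := markov_birth M s ndp.
rewrite jump_moveE -[leLHS]adde0; apply: leeD; last first.
  by rewrite mule_ge0 ?lee_fin ?size_proposal_ge0// (nnm_death M s ndp nf).2.
by rewrite lee_wpmul2r ?(B1 _ nf).2// lee_fin size_proposal_up_ge.
Qed.

Lemma jump_move_stay f z : nnm f -> prior_n M (size_of z.2).+1 = 0%R ->
  (2^-1)%:E * f z <= jump_move M s ndp f z.
Proof.
move=> nf p0; apply: le_trans (jump_move_ge_birth z nf).
rewrite lee_wpmul2l ?lee_fin ?invr_ge0//.
rewrite /birth /metropolis.
have <- : \int[base_x M]_y ((lik M z.1 y)%:E * f z) = f z.
  rewrite ge0_integralZr ?lik_int ?mul1e ?nf.2//.
    by apply/measurable_EFinP; exact: measurable_lik_l.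
  by move=> y _; rewrite lee_fin lik_ge0.
apply: le_integral_nonneg => y; first by rewrite mule_ge0 ?lee_fin ?lik_ge0 ?nf.2.
rewrite lee_wpmul2l ?lee_fin ?lik_ge0// /birth_accept.
have -> : jump_accept M s ndp (append z.2 y) z.2 = 0%R.
  by rewrite jump_acceptE /jump_weight size_append p0 !mul0r min_r.
by rewrite /accept_or_stay mul0e add0e subr0 mul1e.
Qed.

(** The acceptance ratio of a birth with its only data-dependent factor, the ratio of mechanism
    densities, replaced by the bound for sizes [n.+1] and [n]. *)
Definition birth_rate n : R :=
  (Num.min 1 (expR (- eps) ^+ (n.+1 + n) * (prior_n M n.+1 * size_mech M n.+1 ndp *
     size_proposal R n n.+1 / (prior_n M n * size_mech M n ndp *
     size_proposal R n.+1 n))))%R.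

Lemma birth_accept_ge z y : (0 < prior_n M (size_of z.2))%R ->
  (birth_rate (size_of z.2) <= birth_accept M s ndp z y)%R.
Proof.
move=> pn; rewrite /birth_rate /birth_accept jump_acceptE /jump_weight size_append.
set n := size_of z.2; rewrite le_min ge_min lexx /= ge_min; apply/orP; right.
have n0 : (0 < n)%N by [].
set c := (prior_n M n.+1 * _ * _)%R; set e := (_ * _ * size_proposal R n.+1 n)%R.
have c0 : (0 <= c)%R.
  by rewrite /c !mulr_ge0 ?prior_n_ge0 ?size_mech_ge0 ?size_proposal_ge0.
have e0 : (0 < e)%R.
  by rewrite /e !mulr_gt0 ?size_mech_gt0// (lt_le_trans _ (size_proposal_up_ge n0)).
have -> : (prior_n M n.+1 * mech M (append z.2 y) s * size_mech M n.+1 ndp *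
    size_proposal R n n.+1 / (prior_n M n * mech M z.2 s * size_mech M n ndp *
    size_proposal R n.+1 n) = mech M (append z.2 y) s / mech M z.2 s * (c / e))%R.
  rewrite /c /e; field; rewrite !gt_eqF ?mech_gt0 ?size_mech_gt0//.
  by rewrite (lt_le_trans _ (size_proposal_up_ge n0)).
apply: ler_wpM2r; first by rewrite divr_ge0// ltW.
exact: (mech_ratio_ge mech_gt0 mech_dp (append z.2 y) z.2).
Qed.

Lemma birth_rate_gt0 n : (0 < n)%N -> (0 < prior_n M n)%R ->
  (0 < prior_n M n.+1)%R -> (0 < birth_rate n)%R.
Proof.
move=> n0 pn pn1; rewrite lt_min ltr01 mulr_gt0 ?exprn_gt0 ?expR_gt0//.
have q0 : (0 < size_proposal R n n.+1)%R.
  have := @size_proposal_down R n.+1; rewrite /= => ->//.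
  by rewrite eqSS (gtn_eqF n0) invr_gt0.
have q1 : (0 < size_proposal R n.+1 n)%R.
  by rewrite (lt_le_trans _ (size_proposal_up_ge n0)).
by rewrite divr_gt0// !mulr_gt0// size_mech_gt0.
Qed.

Variable K : nat.
Hypothesis prior_K : (0 < prior_n M K.+1)%R.
Hypothesis prior_gtK : forall n, (K.+1 < n)%N -> prior_n M n = 0%R.
Hypothesis prior_up : forall n, (0 < prior_n M n)%R -> (n < K.+1)%N ->
  (0 < prior_n M n.+1)%R.

Local Notation P := (iteration M s ndp).

(** Waiting at the top lets starting sizes at different distances from it regenerate after the same
    number of iterations. *)
Definition next_size n := if (n < K.+1)%N then n.+1 else n.

(** The dual form of a transition bound: from size [n], the jump leads to size [next_size n] with
    probability at least [c]. *)
Lemma jump_move_reach n : (0 < prior_n M n)%R -> exists2 c : R, (0 < c)%R &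
  forall (g : st -> \bar R) (r : R), nnm g -> (0 <= r)%R ->
    (forall z, size_of z.2 = next_size n -> r%:E <= g z) ->
    forall z, size_of z.2 = n -> (c * r)%:E <= jump_move M s ndp g z.
Proof.
move=> pn; rewrite /next_size; case: ifPn => [nK|nK]; last first.
  exists (2^-1)%R => [|g r ng r0 rg z zn]; first by rewrite invr_gt0.
  apply: le_trans (jump_move_stay ng _); last first.
    by apply: prior_gtK; rewrite zn ltnS leqNgt.
  by rewrite EFinM lee_wpmul2l ?lee_fin ?invr_ge0// rg.
have n0 : (0 < n)%N by rewrite lt0n; apply: contraTneq pn => ->; rewrite prior_n0 ltxx.
have k0 := birth_rate_gt0 n0 pn (prior_up pn nK).
exists (2^-1 * birth_rate n)%R => [|g r ng r0 rg z zn].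
  by rewrite mulr_gt0// invr_gt0.
apply: le_trans (jump_move_ge_birth z ng).
rewrite -mulrA EFinM lee_wpmul2l ?lee_fin ?invr_ge0//.
have ka y : (birth_rate n <= birth_accept M s ndp z y)%R.
  by rewrite -zn; apply: birth_accept_ge; rewrite zn.
apply: le_trans (metropolis_ge M (birth_accept01 M s ndp)
  (@measurable_birth_target _ _ Theta X) ng (ltW k0) ka).
rewrite EFinM lee_wpmul2l ?lee_fin ?(ltW k0)//.
rewrite -[leLHS](integral_lik_cst M z.1 r0); apply: le_integral_nonneg => y.
  by rewrite mule_ge0 ?lee_fin ?lik_ge0.
by rewrite lee_wpmul2l ?lee_fin ?lik_ge0// rg//= size_append zn.
Qed.

Lemma iteration_reach n : (0 < prior_n M n)%R -> exists2 c : R, (0 < c)%R &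
  forall (g : st -> \bar R) (r : R), nnm g -> (0 <= r)%R ->
    (forall z, size_of z.2 = next_size n -> r%:E <= g z) ->
    forall z, size_of z.2 = n -> (c * r)%:E <= P g z.
Proof.
move=> /jump_move_reach[c c0 cH]; exists c => // g r ng r0 rg.
have [T1 _ _] := markov_jump_move M s ndp; have [S1 _ _] := markov_sweep M s.
have cr0 : (0 <= c * r)%R by rewrite mulr_ge0// ltW.
(* The parameter draw and the sweep keep the size and preserve constants, so a constant lower bound
   on size [n] passes through them. *)
apply: (size_closed_ge (D := [set n])
  (markov_theta_move a_gt0 lik_gea lik_leB prior_int)) => //.
- exact: (size_closed_theta_move a_gt0 lik_gea lik_leB prior_int).
- by apply: S1; exact: T1.
apply: (size_closed_ge (D := [set n]) (markov_sweep M s)) => //.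
- exact: size_closed_sweep.
- exact: T1.
- exact: cH.
Qed.

Let top_data : dataset X := mkdata [tuple point | i < K.+1].

(** Expectation under the model at size [K.+1]: the parameter comes from the prior, then the records
    are i.i.d. given it. The entries of [top_data] are placeholders, all overwritten. *)
Definition regeneration f : \bar R :=
  \int[base_theta M]_th ((prior M th)%:E * refresh_all K.+1 f (th, top_data)).

Lemma nnm_regeneration f : nnm f ->
  nnm (fun th => (prior M th)%:E * refresh_all K.+1 f (th, top_data)).
Proof.
move=> nf; apply: nnmM; first exact: nnm_prior.
by apply: nnm_section; have [E1 _ _] := markov_refresh_all K.+1; exact: E1.
Qed.

Lemma regenerationD f g : nnm f -> nnm g ->
  regeneration (fun z => f z + g z) = regeneration f + regeneration g.
Proof.
move=> nf ng; have [E1 E2 _] := markov_refresh_all K.+1.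
have [mf f0] := nnm_regeneration nf; have [mg g0] := nnm_regeneration ng.
rewrite /regeneration -ge0_integralD//.
by apply: eq_integral => th _; rewrite E2// ge0_muleDr ?(E1 _ nf).2 ?(E1 _ ng).2.
Qed.

Lemma regeneration_cst (c : R) : (0 <= c)%R -> regeneration (fun=> c%:E) = c%:E.
Proof.
move=> c0; have [_ _ E3] := markov_refresh_all K.+1.
by rewrite /regeneration E3// integral_prior_cst.
Qed.

Lemma le_regeneration f g : nnm f -> nnm g -> (forall z, f z <= g z) ->
  regeneration f <= regeneration g.
Proof.
move=> nf ng fg; apply: le_integral_nonneg => th.
  exact: (nnm_regeneration nf).2.
rewrite lee_wpmul2l ?lee_fin ?prior_ge0//.
by apply: (size_closed_foldr (D := setT) _ markov_refresh) => // i;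
  exact: size_closed_refresh.
Qed.

Lemma iteration_top : exists2 c : R, (0 < c)%R &
  forall f, nnm f -> forall z, size_of z.2 = K.+1 -> c%:E * regeneration f <= P f z.
Proof.
pose e : R := (entry_rate K.+1 ^+ K.+1)%R.
have e0 : (0 < e)%R by rewrite exprn_gt0.
have t0 : (0 < (a / B) ^+ K.+1)%R.
  rewrite exprn_gt0// divr_gt0//.
  exact: (lik_bound_gt0 a_gt0 lik_gea lik_leB).
(* One factor per move: the parameter draw, the [K.+1] entry updates, and the rejected upward
   proposal. *)
exists ((a / B) ^+ K.+1 * (e * 2^-1))%R => [|f nf [th0 x] /= xK].
  by rewrite !mulr_gt0// invr_gt0.
have [J1 _ _] := markov_jump_move M s ndp; have [S1 _ _] := markov_sweep M s.
have [R1 _ _] := markov_refresh_all K.+1.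
have nSJ := S1 _ (J1 _ nf).
apply: (le_trans _ (theta_move_ge a_gt0 lik_gea lik_leB prior_int (th0, x) nSJ)).
rewrite /= xK EFinM -muleA lee_wpmul2l ?lee_fin ?(ltW t0)//.
have c0 : (0 <= e * 2^-1)%R by rewrite mulr_ge0 ?invr_ge0// ltW.
have [mr r0] := nnm_regeneration nf.
rewrite -integralZl_fin//; apply: le_integral_nonneg => th; first by rewrite mule_ge0.
rewrite muleCA lee_wpmul2l ?lee_fin ?prior_ge0//.
have := sweep_ge (th, x) (J1 _ nf); rewrite /= xK; apply: le_trans.
rewrite EFinM -muleA lee_wpmul2l ?lee_fin ?(ltW e0)//.
(* Refreshing forgets all records, so the current dataset may stand for the placeholder of the same
   size. *)
have -> : refresh_all K.+1 f (th, top_data) = refresh_all K.+1 f (th, x).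
  by case: x xK => k v [kK]; subst k; exact: refresh_all_eq.
have h0 : (0 <= (2^-1 : R))%R by rewrite invr_ge0.
rewrite -foldr_refreshZ//.
apply: (size_closed_foldr (D := [set K.+1]) _ markov_refresh) => //.
- by move=> i; exact: size_closed_refresh.
- exact: nnmZ.
- exact: J1.
- move=> w wK; apply: jump_move_stay => //.
  by apply: prior_gtK; rewrite wK.
Qed.

(** The first [k] iterations climb and then wait at the top; the last one regenerates. The outermost
    operator acts first in time, so the induction prepends an iteration. *)
Lemma iter_iteration_ge k n : (0 < prior_n M n)%R -> (K.+1 <= n + k)%N ->
  exists2 c : R, (0 < c)%R &
  forall f (r : R), nnm f -> (0 <= r)%R -> r%:E <= regeneration f ->
    forall z, size_of z.2 = n -> (c * r)%:E <= iter k.+1 P f z.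
Proof.
have leK m : (0 < prior_n M m)%R -> (m <= K.+1)%N.
  by move=> pm; rewrite leqNgt; apply: contraTN pm => /prior_gtK ->; rewrite ltxx.
elim: k n => [|k IH] n pn nK.
  have {nK} -> : n = K.+1 by apply/eqP; rewrite eqn_leq leK//= -(addn0 n).
  have [c c0 cH] := iteration_top; exists c => // f r nf r0 rf z zK.
  apply: le_trans (cH f nf z zK).
  by rewrite EFinM lee_wpmul2l// lee_fin ltW.
have [c' c'0 c'H] : exists2 c : R, (0 < c)%R &
    forall f (r : R), nnm f -> (0 <= r)%R -> r%:E <= regeneration f ->
    forall z, size_of z.2 = next_size n -> (c * r)%:E <= iter k.+1 P f z.
  apply: IH; rewrite /next_size; case: ifPn => [nK1|]; rewrite ?addSnnS//.
    exact: prior_up.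
  by rewrite -leqNgt => nK1; exact: leq_trans (leq_addr _ _).
have [c c0 cH] := iteration_reach pn; exists (c * c')%R; first exact: mulr_gt0.
move=> f r nf r0 rf z zn; rewrite -mulrA.
have mP := markov_iteration s ndp a_gt0 lik_gea lik_leB prior_int.
have [E1 _ _] := markov_iter k.+1 mP.
apply: (cH (iter k.+1 P f)) => //; first exact: E1.
  by rewrite mulr_ge0// ltW.
exact: c'H.
Qed.

(** The constant obtained so far depends on the starting size; only finitely many sizes are
    supported, so a minimum is taken, one size at a time. *)
Lemma uniform_minorization : exists2 c : R, (0 < c < 1)%R &
  forall f (r : R), nnm f -> (0 <= r)%R -> r%:E <= regeneration f ->
    forall z, size_support M (size_of z.2) -> (c * r)%:E <= iter K.+1 P f z.
Proof.
have [c c0 cH] : exists2 c : R, (0 < c)%R & forall n, (n < K.+2)%N ->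
    forall f (r : R), nnm f -> (0 <= r)%R -> r%:E <= regeneration f ->
    forall z, size_of z.2 = n -> (0 < prior_n M n)%R -> (c * r)%:E <= iter K.+1 P f z.
  elim: K.+2 => [|m [c c0 IH]]; first by exists 1%R.
  have [pm|pm] := ltP 0%R (prior_n M m); last first.
    exists c => // n; rewrite ltnS leq_eqVlt => /predU1P[->|/IH//].
    by move=> f r _ _ _ z _; rewrite ltNge pm.
  have m0 : (0 < m)%N by rewrite lt0n; apply: contraTneq pm => ->; rewrite prior_n0 ltxx.
  (* A supported size is at least 1, so [K] climbing iterations suffice from anywhere. *)
  have [c' c'0 IH'] := @iter_iteration_ge K m pm (leq_add m0 (leqnn K)).
  exists (Num.min c c')%R; first by rewrite lt_min c0.
  move=> n nm f r nf r0 rf z zn pn.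
  have [nm'|nm'] := ltnP n m.
    apply: le_trans (IH n nm' f r nf r0 rf z zn pn).
    by rewrite lee_fin ler_wpM2r// ge_min lexx.
  have {nm nm'} nm : n = m by apply/eqP; rewrite eqn_leq nm' andbT -ltnS.
  apply: (le_trans _ (IH' f r nf r0 rf z _)); last by rewrite zn.
  by rewrite lee_fin ler_wpM2r// ge_min lexx orbT.
exists (Num.min c 2^-1)%R.
  by rewrite lt_min c0 invr_gt0 ltr0n /= gt_min invf_lt1// ltr1n orbT.
move=> f r nf r0 rf z pz; apply: (le_trans _ (cH _ _ f r nf r0 rf z erefl pz)).
  by rewrite lee_fin ler_wpM2r// ge_min lexx.
rewrite ltnS leqNgt; apply: contraTN pz => /prior_gtK.
by rewrite /size_support /= => ->; rewrite ltxx.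
Qed.

End minorization.

(** * Contraction of the oscillation *)

Section contraction.
Local Open Scope ereal_scope.
Context (R : realType) dT dX (Theta : measurableType dT) (X : measurableType dX).
Local Notation st := (Theta * dataset X)%type.
Variables (Q : (st -> \bar R) -> st -> \bar R) (D : set nat)
  (nu : (st -> \bar R) -> \bar R) (c : R) (z0 : st).
Hypothesis markovQ : markov_op Q.
Hypothesis size_closedQ : size_closed D Q.
Hypothesis nuD : forall f g, nnm f -> nnm g -> nu (fun z => f z + g z) = nu f + nu g.
Hypothesis nu_cst : forall r : R, (0 <= r)%R -> nu (fun=> r%:E) = r%:E.
Hypothesis le_nu : forall f g, nnm f -> nnm g -> (forall z, f z <= g z) -> nu f <= nu g.
Hypothesis c01 : (0 < c < 1)%R.
Hypothesis Dz0 : D (size_of z0.2).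
Hypothesis minorization : forall f (r : R), nnm f -> (0 <= r)%R -> r%:E <= nu f ->
  forall z, D (size_of z.2) -> (c * r)%:E <= Q f z.

(* Doeblin: apply the minorization to both [f - lo] and [hi - f]. *)
Lemma oscillation_contraction f (lo hi : R) : nnm f -> (0 <= lo)%R ->
  (forall z : st, D (size_of z.2) -> lo%:E <= f z <= hi%:E) ->
  exists lo' hi' : R, [/\ (0 <= lo')%R,
    forall z : st, D (size_of z.2) -> lo'%:E <= Q f z <= hi'%:E &
    (hi' - lo' <= (1 - c) * (hi - lo))%R].
Proof.
move=> nf lo0 f_lohi; have [c0 c1] := andP c01.
have [Q1 Q2 Q3] := markovQ.
have lohi : (lo <= hi)%R.
  by have /andP[l h] := f_lohi z0 Dz0; rewrite -lee_fin (le_trans l).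
have hi0 : (0 <= hi)%R := le_trans lo0 lohi.
(* The bounds on [f] hold only on [D]; truncation keeps both differences nonnegative elsewhere and
   changes nothing on [D]. *)
pose above z := maxe (f z - lo%:E) 0; pose below z := maxe (hi%:E - f z) 0.
have nabove : nnm above.
  split=> [|z]; last by rewrite le_max lexx orbT.
  by apply: measurable_maxe => //; apply: emeasurable_funB => //; exact: nf.1.
have nbelow : nnm below.
  split=> [|z]; last by rewrite le_max lexx orbT.
  by apply: measurable_maxe => //; apply: emeasurable_funB => //; exact: nf.1.
have below_hi z : below z <= hi%:E.
  rewrite ge_max lee_fin hi0 andbT -[leRHS]adde0.
  by apply: leeD2l; rewrite leeNl oppe0 nf.2.
have nu_below : nu below <= hi%:E.
  by rewrite -nu_cst//; apply: le_nu => //; exact: nnm_cst.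
have nu_ge0 g : nnm g -> 0 <= nu g.
  move=> ng; apply: (@le_trans _ _ (nu (fun=> 0%:E))); first by rewrite nu_cst.
  exact: le_nu (nnm_cst _ (lexx 0%R)) ng ng.2.
have fin_below : nu below \is a fin_num.
  by rewrite ge0_fin_numE ?nu_ge0// (le_lt_trans nu_below) ?ltry.
have fE z : D (size_of z.2) -> exists2 r : R, f z = r%:E & (lo <= r <= hi)%R.
  move=> Dz; have := f_lohi z Dz; case: (f z) => [r||].
  - by rewrite !lee_fin => ?; exists r.
  - by rewrite leye_eq andbF.
  - by rewrite leeNy_eq.
(* [nu below] is at most [hi], but [nu above] may be infinite, as [f] is unbounded off [D]. The real
   [r] replaces it: [above + below] is at least [hi - lo] everywhere, so [r] is below [nu above]. *)
pose r' := fine (nu below); pose r := Num.max 0%R (hi - lo - r')%R.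
have r'0 : (0 <= r')%R by rewrite fine_ge0// nu_ge0.
have r0 : (0 <= r)%R by rewrite le_max lexx.
have r_nu : r%:E <= nu above.
  rewrite /r EFin_max ge_max nu_ge0//= EFinB /r' fineK// leeBlDr//.
  rewrite -nuD// -nu_cst ?subr_ge0//; apply: le_nu => //.
  - by apply: nnm_cst; rewrite subr_ge0.
  - exact: nnmD.
  move=> w; rewrite /above /below; have := nf.2 w; case: (f w) => [t t0|_|//].
    rewrite -!EFinB -!EFin_max -EFinD lee_fin.
    have -> : (hi - lo = (t - lo) + (hi - t))%R by ring.
    by apply: lerD; rewrite le_max lexx.
  rewrite addye ?leey//.
  by rewrite gt_eqF// lt_max ltNy0 orbT.
(* The gap shrinks by [c * (r + r')], and [r + r'] is at least [hi - lo]. *)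
exists (lo + c * r)%R, (hi - c * r')%R; split.
- by rewrite addr_ge0// mulr_ge0// ltW.
- move=> z Dz; apply/andP; split.
    have crQ := minorization nabove r0 r_nu Dz.
    have nlo : nnm (fun _ : st => lo%:E) by exact: nnm_cst.
    have : Q (fun w => lo%:E + above w) z <= Q f z.
      apply: (size_closedQ (nnmD nlo nabove) nf _ Dz).
      move=> w /fE[t ft /andP[lot thi]].
      by rewrite /above ft -EFinB -EFin_max -EFinD lee_fin max_l ?subr_ge0// addrC subrK.
    by apply: le_trans; rewrite Q2// Q3// EFinD leeD2l.
  have crQ : (c * r')%:E <= Q below z.
    by apply: minorization => //; rewrite /r' fineK.
  have : Q (fun w => f w + below w) z <= Q (fun=> hi%:E) z.
    apply: (size_closedQ (nnmD nf nbelow) (nnm_cst _ hi0) _ Dz).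
    move=> w /fE[t ft /andP[lot thi]].
    by rewrite /below ft -EFinB -EFin_max -EFinD lee_fin max_l ?subr_ge0// addrC subrK.
  rewrite Q2// Q3// EFinB => Qhi; rewrite leeBrDr//.
  by apply: le_trans Qhi; exact: leeD2l.
have rr' : (hi - lo <= r + r')%R by rewrite -lerBlDr le_max lexx orbT.
have -> : (hi - c * r' - (lo + c * r) = hi - lo - c * (r + r'))%R by ring.
by rewrite mulrBl mul1r lerB// ler_wpM2l// ltW.
Qed.

Lemma oscillation_iter f q : nnm f -> (forall z, f z <= 1) ->
  exists lo hi : R, [/\ (0 <= lo)%R,
    forall z : st, D (size_of z.2) -> lo%:E <= iter q Q f z <= hi%:E &
    (hi - lo <= (1 - c) ^+ q)%R].
Proof.
move=> nf f1; elim: q => [|q [lo [hi [lo0 lohi osc]]]].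
  by exists 0%R, 1%R; split=> //= [z _|]; rewrite ?nf.2 ?f1// subr0 expr0.
have [E1 _ _] := markov_iter q markovQ.
have [lo' [hi' [lo'0 lohi' osc']]] := oscillation_contraction (E1 _ nf) lo0 lohi.
exists lo', hi'; split=> //; apply: le_trans osc' _.
by rewrite exprS ler_wpM2l// subr_ge0 ltW; case/andP: c01.
Qed.

End contraction.

(** * From a rate per block of iterations to a rate per iteration *)

Lemma one_sub_expr_ge (R : realDomainType) (x : R) n : 0 <= x <= 1 ->
  1 - n%:R * x <= (1 - x) ^+ n.
Proof.
move=> /andP[x0 x1]; elim: n => [|n IH]; first by rewrite mul0r subr0 expr0.
have y0 : 0 <= 1 - x by rewrite subr_ge0.
rewrite exprS; apply: le_trans (ler_wpM2l y0 IH).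
have -> : (1 - x) * (1 - n%:R * x) = 1 - n.+1%:R * x + n%:R * x ^+ 2.
  by rewrite -addn1 natrD; ring.
by rewrite lerDl mulr_ge0// sqr_ge0.
Qed.

(* By Bernoulli's inequality, [rho := 1 - c / (K + 1)] will do. *)
Lemma per_step_rate (R : realType) (c : R) (K : nat) : 0 < c < 1 ->
  exists rho C : R, [/\ 0 < rho, rho < 1 &
    forall t, (1 - c) ^+ (t %/ K.+1) <= C * rho ^+ t].
Proof.
move=> /andP[c0 c1]; pose rho : R := 1 - c / K.+1%:R.
have K0 : 0 < K.+1%:R :> R by rewrite ltr0n.
have x1 : c / K.+1%:R < 1.
  by rewrite ltr_pdivrMr// mul1r (lt_le_trans c1)// ler1n.
have x0 : 0 < c / K.+1%:R by rewrite divr_gt0.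
have rho0 : 0 < rho by rewrite subr_gt0.
(* The constant pays for the incomplete block, which has fewer than [K.+1] iterations. *)
exists rho, (rho ^+ K.+1)^-1; split=> // [|t]; first by rewrite ltrBlDr ltrDl.
rewrite mulrC ler_pdivlMr ?exprn_gt0//.
have rc : 1 - c <= rho ^+ K.+1.
  have := @one_sub_expr_ge _ (c / K.+1%:R) K.+1; rewrite (ltW x0) (ltW x1) => /(_ isT).
  by rewrite mulrC divfK// gt_eqF.
rewrite [X in _ <= rho ^+ X](divn_eq t K.+1) exprD mulnC exprM.
apply: ler_pM.
- by rewrite exprn_ge0// subr_ge0 ltW.
- by rewrite exprn_ge0// ltW.
- by apply: lerXn2r; rewrite ?nnegrE ?subr_ge0 ?(ltW c1) ?exprn_ge0 ?(ltW rho0).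
rewrite ler_wiXn2l// ?(ltW rho0)//; first by rewrite lerBlDr lerDl ltW.
by rewrite ltnW// ltn_mod.
Qed.

Lemma scaled_between (R : realType) (e lo hi : R) (I : \bar R) : 0 < e ->
  ((lo * e)%:E <= I <= (hi * e)%:E -> lo%:E <= e^-1%:E * I <= hi%:E)%E.
Proof.
move=> e0; case: I => [i| |]; [|by rewrite leye_eq andbF|by rewrite leeNy_eq].
by rewrite -EFinM !lee_fin (mulrC e^-1) ler_pdivlMr// ler_pdivrMr.
Qed.

(** * Normalization of the posterior and its averages *)

Section posterior.
Local Open Scope ereal_scope.
Context (R : realType) dT dX dS dN (Theta : measurableType dT)
  (X : measurableType dX) (S : measurableType dS) (N : measurableType dN)
  (V : nmodType) (M : model R Theta X S N V) (s : S) (ndp : N).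
Local Notation st := (Theta * dataset X)%type.
Local Notation TI := (tuple_integral M).
Local Notation J := (joint_density M s ndp).
Implicit Types (f g h : st -> \bar R) (z : st) (x : dataset X).

Lemma size_integralZl k (c : R) h : (0 <= c)%R -> nnm h ->
  size_integral M k (fun z => c%:E * h z) = c%:E * size_integral M k h.
Proof.
move=> c0 nh; have [mi i0] := nnm_fiber_integral M k nh.
rewrite /size_integral -integralZl_fin//; apply: eq_integral => th _.
by have [? ?] := nnm_fiber_th k th nh; exact: tuple_integralZl.
Qed.

Lemma state_integralZl (c : R) h : (0 <= c)%R -> nnm h ->
  state_integral M (fun z => c%:E * h z) = c%:E * state_integral M h.
Proof.
move=> c0 nh; rewrite !state_integralE -nneseriesZl.
  by apply: eq_eseriesr => k _; exact: size_integralZl.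
by move=> k _; apply: size_integral_ge0; exact: nh.2.
Qed.

Lemma tuple_integral_lik n th :
  TI (fun v : n.-tuple X => (\prod_(y <- v) lik M th y)%:E) = 1.
Proof.
elim: n => [|n IH] /=; first by rewrite big_nil.
rewrite -[RHS](lik_int M th); apply: eq_integral => y _.
transitivity (TI (fun v : n.-tuple X =>
    (lik M th y)%:E * (\prod_(y <- v) lik M th y)%:E)).
  by congr TI; apply/funext => v; rewrite big_cons EFinM.
rewrite tuple_integralZl ?lik_ge0//; first by rewrite IH mule1.
  by move=> v; rewrite lee_fin prodr_ge0// => w _; exact: lik_ge0.
apply/measurable_EFinP; under eq_fun do rewrite big_tuple.
apply: measurable_prod => i _.
by apply: (measurableT_comp (measurable_lik_l M th)); exact: measurable_tnth.
Qed.

Hypothesis prior_int : \int[base_theta M]_th (prior M th)%:E = 1.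

(** The reference probability at a fixed size; the evidence is bounded from above and from below by
    comparison with it. *)
Lemma size_integral_theta_weight k :
  size_integral M k (fun z => (prior M z.1 * lik_data M z.1 z.2)%:E) = 1.
Proof.
rewrite -[RHS]prior_int; apply: eq_integral => th _.
transitivity (TI (fun v : k.+1.-tuple X =>
    (prior M th)%:E * (lik_data M th (mkdata v))%:E)).
  by congr TI; apply/funext => v; rewrite -EFinM.
rewrite tuple_integralZl ?prior_ge0//.
- by rewrite (tuple_integral_lik k.+1 th) mule1.
- by move=> v; rewrite lee_fin lik_data_ge0.
- apply/measurable_EFinP.
  apply: (measurableT_comp (measurable_lik_data M)
    (g := fun v : k.+1.-tuple X => (th, mkdata v))).
  by apply: measurable_fun_pair => //; exact: (@measurable_mkdata _ _ k).
Qed.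

Variable eps Bs : R.
Hypothesis mech_gt0 : forall x, (0 < mech M x s)%R.
Hypothesis mech_dp : dp_density (@neighbor X) eps (mech M).
Hypothesis mech_leB : forall x, (mech M x s <= Bs)%R.
Hypothesis size_mech_gt0 : forall n, (0 < n)%N -> (0 < size_mech M n ndp)%R.
Variable K : nat.
Hypothesis prior_K : (0 < prior_n M K.+1)%R.
Hypothesis prior_gtK : forall n, (K.+1 < n)%N -> prior_n M n = 0%R.

Lemma joint_density_weight z : J z = (prior_n M (size_of z.2) * mech M z.2 s *
  size_mech M (size_of z.2) ndp * (prior M z.1 * lik_data M z.1 z.2))%R.
Proof. by rewrite /joint_density; ring. Qed.

Lemma joint_density_eq0 z : ~ size_support M (size_of z.2) -> J z = 0%R.
Proof.
move=> Dz; rewrite /joint_density.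
have -> : prior_n M (size_of z.2) = 0%R.
  apply/eqP; move: Dz.
  by rewrite /size_support /= lt0r prior_n_ge0 andbT => /negP; rewrite negbK.
by rewrite mulr0 !mul0r.
Qed.

Lemma nneseries_joint_density : state_integral M (fun z => (J z)%:E) =
  \sum_(0 <= k < K.+1) size_integral M k (fun z => (J z)%:E).
Proof.
rewrite state_integralE (nneseries_split 0%N K.+1); last first.
  move=> k _; apply: size_integral_ge0 => z; rewrite lee_fin.
  exact: joint_density_ge0.
rewrite add0n eseries0 ?adde0// => k Kk _.
apply: size_integral_eq0 => th v.
rewrite joint_density_eq0// /size_support /= prior_gtK ?ltxx//.
Qed.

Lemma state_integral_joint_density_lty :
  state_integral M (fun z => (J z)%:E) < +oo.
Proof.
rewrite nneseries_joint_density; apply: lte_sum_pinfty => k _.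
pose C := (prior_n M k.+1 * Bs * size_mech M k.+1 ndp)%R.
have Bs0 : (0 <= Bs)%R := le_trans (mech_ge0 M point s) (mech_leB _).
have C0 : (0 <= C)%R by rewrite /C !mulr_ge0 ?prior_n_ge0 ?size_mech_ge0.
apply: (@le_lt_trans _ _ (size_integral M k (fun z =>
    C%:E * (prior M z.1 * lik_data M z.1 z.2)%:E))); last first.
  by rewrite size_integralZl ?size_integral_theta_weight ?mule1 ?ltry//;
    exact: nnm_theta_weight.
apply: le_integral_nonneg => th.
  by apply: tuple_integral_ge0 => v; rewrite lee_fin joint_density_ge0.
apply: le_tuple_integral => v; first by rewrite lee_fin joint_density_ge0.
rewrite joint_density_weight -EFinM lee_fin ler_wpM2r//.
  by rewrite mulr_ge0 ?prior_ge0 ?lik_data_ge0.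
by rewrite ler_wpM2r ?size_mech_ge0// ler_wpM2l ?prior_n_ge0.
Qed.

Lemma state_integral_joint_density_gt0 :
  0 < state_integral M (fun z => (J z)%:E).
Proof.
pose x0 : dataset X := point.
(* A lower bound for the mechanism density, uniform over datasets of size [K.+1], by comparison with
   one fixed dataset. *)
pose m := (expR (- eps) ^+ (K.+1 + size_of x0) * mech M x0 s)%R.
pose C := (prior_n M K.+1 * m * size_mech M K.+1 ndp)%R.
have C0 : (0 < C)%R.
  by rewrite /C /m !mulr_gt0 ?exprn_gt0 ?expR_gt0 ?size_mech_gt0.
apply: (@lt_le_trans _ _ (size_integral M K (fun z => (J z)%:E))); last first.
  rewrite nneseries_joint_density big_nat_recr//= leeDr// sume_ge0// => k _.
  by apply: size_integral_ge0 => z; rewrite lee_fin joint_density_ge0.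
apply: (@lt_le_trans _ _ (size_integral M K (fun z =>
    C%:E * (prior M z.1 * lik_data M z.1 z.2)%:E))).
  rewrite size_integralZl ?size_integral_theta_weight ?mule1 ?lte_fin ?ltW//.
  exact: nnm_theta_weight.
apply: le_integral_nonneg => th.
  apply: tuple_integral_ge0 => v.
  by rewrite -EFinM lee_fin mulr_ge0 ?(ltW C0)// mulr_ge0 ?prior_ge0 ?lik_data_ge0.
apply: le_tuple_integral => v.
  by rewrite -EFinM lee_fin mulr_ge0 ?(ltW C0)// mulr_ge0 ?prior_ge0 ?lik_data_ge0.
rewrite joint_density_weight -EFinM lee_fin ler_wpM2r//.
  by rewrite mulr_ge0 ?prior_ge0 ?lik_data_ge0.
rewrite ler_wpM2r ?size_mech_ge0// ler_wpM2l ?prior_n_ge0//.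
exact: (mech_comparable s mech_dp (mkdata v) x0).
Qed.

Definition evidence : R := fine (state_integral M (fun z => (J z)%:E)).

Lemma evidenceE : state_integral M (fun z => (J z)%:E) = evidence%:E.
Proof.
rewrite fineK// ge0_fin_numE ?state_integral_joint_density_lty//.
exact: ltW state_integral_joint_density_gt0.
Qed.

Lemma evidence_gt0 : (0 < evidence)%R.
Proof. by rewrite -lte_fin -evidenceE state_integral_joint_density_gt0. Qed.

(** Off the supported sizes [J] is 0 and annihilates even an infinite value of [f], so bounds on the
    supported sizes are enough. *)
Lemma state_integral_joint_between f (lo hi : R) : nnm f ->
  (0 <= lo)%R -> (0 <= hi)%R ->
  (forall z, size_support M (size_of z.2) -> lo%:E <= f z <= hi%:E) ->
  (lo * evidence)%:E <= state_integral M (fun z => (J z)%:E * f z) <=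
  (hi * evidence)%:E.
Proof.
move=> nf lo0 hi0 f_lohi.
have J0 z : 0 <= (J z)%:E by rewrite lee_fin joint_density_ge0.
rewrite !EFinM -evidenceE -!state_integralZl//; try exact: nnm_joint_density.
apply/andP; split; apply: le_state_integral => z.
- by rewrite mule_ge0.
- have [/f_lohi/andP[lof _]|/joint_density_eq0 ->] :=
    pselect (size_support M (size_of z.2)); last by rewrite mule0 mul0e.
  by rewrite muleC lee_wpmul2l.
- by rewrite mule_ge0 ?nf.2.
- have [/f_lohi/andP[_ fhi]|/joint_density_eq0 ->] :=
    pselect (size_support M (size_of z.2)); last by rewrite mule0 mul0e.
  by rewrite [leRHS]muleC lee_wpmul2l.
Qed.

Lemma posteriorE (U : set st) : posterior M s ndp U =
  (evidence^-1)%:E * state_integral M (fun z => (J z)%:E * (\1_U z)%:E).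
Proof. by []. Qed.

(** Meant for [f] the image of the indicator of [U] under several iterations, for which stationarity
    gives the last hypothesis. *)
Lemma posterior_between f U (lo hi : R) : nnm f ->
  (0 <= lo)%R -> (0 <= hi)%R ->
  (forall z, size_support M (size_of z.2) -> lo%:E <= f z <= hi%:E) ->
  state_integral M (fun z => (J z)%:E * f z) =
    state_integral M (fun z => (J z)%:E * (\1_U z)%:E) ->
  lo%:E <= posterior M s ndp U <= hi%:E.
Proof.
move=> nf lo0 hi0 f_lohi fU; rewrite posteriorE -fU.
exact: scaled_between evidence_gt0 (state_integral_joint_between nf lo0 hi0 f_lohi).
Qed.

Lemma posterior_size_support :
  posterior M s ndp (~` [set z | size_support M (size_of z.2)]) = 0.
Proof.
rewrite posteriorE state_integralE eseries0 ?mule0// => k _ _.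
apply: size_integral_eq0 => th v; rewrite indicE.
have [Dz|Dz] := pselect (size_support M (size_of (mkdata v))).
  by rewrite memNset ?mule0//= => /(_ Dz).
by rewrite joint_density_eq0// mul0e.
Qed.

End posterior.

(** * Convergence in total variation *)

Section geometric_ergodicity.
Local Open Scope ereal_scope.
Context (R : realType) dT dX dS dN (Theta : measurableType dT)
  (X : measurableType dX) (S : measurableType dS) (N : measurableType dN)
  (V : nmodType) (M : model R Theta X S N V) (s : S) (ndp : N).
Local Notation st := (Theta * dataset X)%type.
Local Notation P := (iteration M s ndp).

Lemma largest_size : finite_set [set n : nat | (0 < prior_n M n)%R] ->
  exists K, (0 < prior_n M K.+1)%R /\
    forall n, (K.+1 < n)%N -> prior_n M n = 0%R.
Proof.
move=> /finite_seqP[F FE].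
have bound n : (0 < prior_n M n)%R -> (n <= \max_(m <- F) m)%N.
  move=> pn; have nF : n \in F by have : [set` F] n by rewrite -FE.
  exact: (leq_bigmax_seq (F := id) n nF).
have ex : exists n, (0 < prior_n M n)%R.
  apply/not_existsP => no; have := prior_n_sum M.
  rewrite eseries0; first by move=> /eqP; rewrite eq_sym onee_eq0.
  move=> n _ _; congr EFin; apply/eqP; rewrite eq_le prior_n_ge0 andbT leNgt.
  exact/negP.
case: (ex_maxnP ex bound) => -[|K] pK maxK; first by rewrite prior_n0 ltxx in pK.
exists K; split=> // n; rewrite ltnNge => /negP nK; apply/eqP.
by rewrite eq_le prior_n_ge0 andbT leNgt; apply/negP => /maxK.
Qed.

Lemma stationary_iter (Q : (st -> \bar R) -> st -> \bar R) t :
  markov_op Q -> stationary M s ndp Q ->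
  stationary M s ndp (fun f => iter t Q f).
Proof.
move=> mQ sQ; elim: t => [|t IH]; first by move=> f _.
exact: stationary_comp (markov_iter t mQ) sQ IH.
Qed.

Variables (a B eps Bs : R).
Hypothesis a_gt0 : (0 < a)%R.
Hypothesis lik_gea : forall th y, (a <= lik M th y)%R.
Hypothesis lik_leB : forall th y, (lik M th y <= B)%R.
Hypothesis prior_int : \int[base_theta M]_th (prior M th)%:E = 1.
Hypothesis mech_gt0 : forall x : dataset X, (0 < mech M x s)%R.
Hypothesis mech_dp : dp_density (@neighbor X) eps (mech M).
Hypothesis mech_leB : forall x : dataset X, (mech M x s <= Bs)%R.
Hypothesis size_mech_gt0 : forall n, (0 < n)%N -> (0 < size_mech M n ndp)%R.
Variable K : nat.
Hypothesis prior_K : (0 < prior_n M K.+1)%R.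
Hypothesis prior_gtK : forall n, (K.+1 < n)%N -> prior_n M n = 0%R.
Hypothesis prior_up : forall n, (0 < prior_n M n)%R -> (n < K.+1)%N ->
  (0 < prior_n M n.+1)%R.

Lemma stationary_iteration : stationary M s ndp P.
Proof.
have mS := markov_sweep M s; have mJ := markov_jump_move M s ndp.
apply: (stationary_comp (markov_comp mS mJ)).
  exact: (stationary_theta_move s ndp a_gt0 lik_gea lik_leB prior_int).
exact: (stationary_comp mJ (@stationary_sweep _ _ _ _ _ Theta X S N V M s ndp)
  (@stationary_jump_move _ _ _ _ _ Theta X S N V M s ndp)).
Qed.

Lemma chain_oscillation : exists2 c : R, (0 < c < 1)%R &
  forall t (U : set st), measurable U -> exists lo hi : R,
  [/\ (0 <= lo)%R,
    forall z : st, size_support M (size_of z.2) ->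
      lo%:E <= chain M s ndp t z U <= hi%:E &
    (hi - lo <= (1 - c) ^+ (t %/ K.+1))%R].
Proof.
have mP : markov_op P by exact: (markov_iteration s ndp a_gt0 lik_gea lik_leB prior_int).
have cP : size_closed (size_support M) P.
  exact: (size_closed_iteration s ndp a_gt0 lik_gea lik_leB prior_int).
have [c c01 minor] := uniform_minorization a_gt0 lik_gea lik_leB prior_int
  mech_gt0 mech_dp size_mech_gt0 prior_gtK prior_up.
exists c => // t U mU.
pose f (z : st) : \bar R := (\1_U z)%:E.
have nf : nnm f.
  by apply: nnm_EFin => [|z]; [exact: measurable_indic|rewrite indicE ler0n].
have f1 z : f z <= 1 by rewrite lee_fin indicE lern1 leq_b1.
pose z0 : st := (point, mkdata [tuple point | i < K.+1]).
have [lo [hi [lo0 lohi osc]]] := oscillation_iter (z0 := z0) (markov_iter K.+1 mP)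
  (size_closed_iter K.+1 mP cP)
  (@regenerationD _ _ _ _ _ Theta X S N V M K) (regeneration_cst prior_int K)
  (@le_regeneration _ _ _ _ _ Theta X S N V M K) c01 prior_K minor (t %/ K.+1) nf f1.
exists lo, hi; split; [exact: lo0| |exact: osc] => z Dz.
have [E1 _ _] := markov_iter (t %/ K.+1) (markov_iter K.+1 mP).
have hi0 : (0 <= hi)%R.
  have /andP[l h] := lohi z0 prior_K.
  by rewrite -lee_fin (le_trans _ h)// (le_trans _ l)// lee_fin.
have mr := markov_iter (t %% K.+1) mP.
have cr := size_closed_iter (t %% K.+1) mP cP.
(* The remaining [t %% K.+1] iterations are placed outermost: they average values already between
   [lo] and [hi], so they preserve these bounds. *)
have -> : chain M s ndp t z U =
    iter (t %% K.+1) P (iter (t %/ K.+1) (fun g => iter K.+1 P g) f) z.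
  by rewrite /chain [in LHS](divn_eq t K.+1) addnC iterD iterM.
apply/andP; split.
  by apply: (size_closed_ge mr cr (E1 _ nf) lo0 _ Dz) => w /lohi/andP[].
by apply: (size_closed_le mr cr (E1 _ nf) hi0 _ Dz) => w /lohi/andP[].
Qed.

(** For each event, one interval contains its probability under the chain from every supported
    state, and its posterior. The bound on the length of the interval is the same for all events, so
    it passes to the supremum. *)
Lemma tv_dist_chain : exists2 c : R, (0 < c < 1)%R &
  forall t (z : st), size_support M (size_of z.2) ->
    tv_dist (chain M s ndp t z) (posterior M s ndp) <=
      ((1 - c) ^+ (t %/ K.+1))%:E.
Proof.
have [c c01 osc] := chain_oscillation; exists c => // t z Dz.
apply: ge_ereal_sup => _ [U mU <-].
have [lo [hi [lo0 lohi hilo]]] := osc t U mU.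
have mP : markov_op P by exact: (markov_iteration s ndp a_gt0 lik_gea lik_leB prior_int).
pose f (w : st) : \bar R := (\1_U w)%:E.
have nf : nnm f.
  by apply: nnm_EFin => [|w]; [exact: measurable_indic|rewrite indicE ler0n].
have hi0 : (0 <= hi)%R.
  have /andP[l h] := lohi z Dz.
  by rewrite -lee_fin (le_trans _ h)// (le_trans _ l)// lee_fin.
have [E1 _ _] := markov_iter t mP.
have := posterior_between prior_int mech_gt0 mech_dp mech_leB size_mech_gt0
  prior_K prior_gtK (E1 _ nf) lo0 hi0 lohi (stationary_iter t mP stationary_iteration nf).
have := lohi z Dz.
case: (chain _ _ _ _ _ _) => [p| |]; last 2 first.
- by rewrite leye_eq andbF.
- by rewrite leeNy_eq.
case: (posterior _ _ _ _) => [q| |]; last 2 first.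
- by rewrite leye_eq andbF.
- by rewrite leeNy_eq.
rewrite -EFinB !lee_fin => /andP[lop phi] /andP[loq qhi].
apply: le_trans hilo; rewrite ler_norml; apply/andP; split; last exact: lerB.
by rewrite opprB; exact: lerB.
Qed.

End geometric_ergodicity.

Theorem proposition5p4 (R : realType) (dT dX dS dN : measure_display)
    (Theta : measurableType dT) (X : measurableType dX)
    (S : measurableType dS) (N : measurableType dN) (V : nmodType)
    (M : model R Theta X S N V) (s : S) (ndp : N) (eps_s eps_n a : R)
    (s_supp : forall x : dataset X, 0 < mech M x s)
    (ndp_supp : forall n : nat, (0 < n)%N -> 0 < size_mech M n ndp)
    (E1 : countably_generated (Theta * dataset X)%type)
    (E2_theta : exists B : R, forall th, prior M th <= B)
    (E2_x : bounded_density (lik M))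
    (E2_s : bounded_density (mech M))
    (E3 : forall i j k : nat, (i < j)%N -> (j < k)%N ->
       0 < prior_n M i -> 0 < prior_n M k -> 0 < prior_n M j)
    (E4_x : same_support [set: Theta] (lik M))
    (E4_s : same_support [set: dataset X] (mech M))
    (E4_n : same_support [set n : nat | (0 < n)%N] (size_mech M))
    (H1 : (\int[base_theta M]_th (prior M th)%:E = 1)%E)
    (H2_s : dp_density (@neighbor X) eps_s (mech M))
    (H2_n : dp_density neighbor_size eps_n (size_mech M))
    (a_gt0 : 0 < a)
    (H3 : forall th y, a < lik M th y)
    (H4 : finite_set [set n : nat | 0 < prior_n M n]) :
  geometrically_ergodic (chain M s ndp) (posterior M s ndp).
Proof.
have [K [prior_K prior_gtK]] := largest_size H4.
(* The support of the prior on sizes has no gaps, so the climb can proceed one size at a time. *)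
have prior_up n : 0 < prior_n M n -> (n < K.+1)%N -> 0 < prior_n M n.+1.
  move=> pn; rewrite leq_eqVlt eqSS => /predU1P[->//|nK].
  exact: E3 (ltnSn n) nK pn prior_K.
have [B lik_leB] := E2_x; have [Bs mech_leB] := E2_s.
have [c c01 tv] := tv_dist_chain a_gt0 (fun th y => ltW (H3 th y)) lik_leB H1
  s_supp H2_s (fun x => mech_leB x s) ndp_supp prior_K prior_gtK prior_up.
have [rho [C [rho0 rho1 rate]]] := per_step_rate K c01.
exists rho; split => //.
(* The exceptional null set consists of the states of unsupported size; on its complement a single
   [C] serves all starting states. *)
exists (~` [set z : Theta * dataset X | size_support M (size_of z.2)]); split.
- apply: measurableC.
  have := @measurable_snd _ _ Theta (dataset X) measurableT
    [set x : dataset X | size_support M (size_of x)].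
  by rewrite setTI; apply; exact: measurable_of_size.
- exact: posterior_size_support.
- move=> z /= nz Dz; apply: nz; exists C => t.
  by apply: le_trans (tv t z Dz) _; rewrite lee_fin.
Qed.
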